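(* Let $\mathcal{C}$ be a monoidal category with coequalizers in which every object is coflat and left robust. Then for an algebra extension $i:R\to S$ in $\mathcal{C}$ the following assertions are equivalent: (i) The extension $i:R\to S$ is Frobenius. (ii) $S$ admits a left dual object $S^*$ in ${}_R\mathcal{C}_R$, and $S$ and $S^*$ are isomorphic as right $S$-modules in ${}_R\mathcal{C}_R$. (iii) $S$ admits a right dual object ${}^*S$ in ${}_R\mathcal{C}_R$, and $S$ and ${}^*S$ are isomorphic as left $S$-modules in ${}_R\mathcal{C}_R$. (iv) $S$ admits a coalgebra structure in ${}_R\mathcal{C}_R$ (an $R$-coring structure) whose comultiplication is $S$-bilinear in ${}_R\mathcal{C}_R$. (v) $S$ admits a right dual ${}^*S$ in ${}_R\mathcal{C}_R$ and there exists a morphism $B:S\otimes_RS\to R$ in ${}_R\mathcal{C}_R$ that is associative and such that $\Phi^r_B:=\Upsilon_{{}^*S}\,\widetilde{B}\,\Sigma'_{{}^*S,S,S}\,\widehat{\mathrm{coev}'_S}\,\Upsilon'^{-1}_S:S\to{}^*S$ is an isomorphism in ${}_R\mathcal{C}_R$. (vi) $S$ admits a left dual $S^*$ in ${}_R\mathcal{C}_R$ and there exists a morphism $B:S\otimes_RS\to R$ in ${}_R\mathcal{C}_R$ that is associative and such that $\Phi^l_B:=\Upsilon'_{S^*}\,\widehat{B}\,\Gamma'_{S,S,S^*}\,\widetilde{\mathrm{coev}_S}\,\Upsilon^{-1}_S:S\to S^*$ is an isomorphism in ${}_R\mathcal{C}_R$. (vii) There exists an adjunction $(\rho,\lambda):S\dashv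 S$ in ${}_R\mathcal{C}_R$ for which $\lambda:S\otimes_RS\to R$ is associative. (viii) There exists an adjunction $(\rho,\lambda):S\dashv S$ in ${}_R\mathcal{C}_R$ such that $\lambda=\vartheta\,m^R_S$ for some morphism $\vartheta:S\to R$ in ${}_R\mathcal{C}_R$. Furthermore, if $R$ is a left $\otimes_R$-generator of ${}_R\mathcal{C}_R$, then assertions (i)–(viii) are also equivalent to (ix) $-\otimes_RS:{}_R\mathcal{C}_R\to{}_R\mathcal{C}_S$ is a right adjoint of the forgetful functor $F:{}_R\mathcal{C}_S\to{}_R\mathcal{C}_R$ (in other words, $F$ is a Frobenius functor).
   Context: Monoidal categories are taken strict, with tensor product $\otimes$ and unit object $\underline{1}$; $m_A,\eta_A$ denote multiplication and unit of an algebra $A$. ${}_A\mathcal{C}_B$ is the category of $(A,B)$-bimodules in $\mathcal{C}$. An object $X$ is coflat if $X\otimes-$ and $-\otimes X$ preserve coequalizers. For an algebra $R$, a right $R$-module $(X,\nu^R_X)$ and a left $R$-module $(Y,\mu^R_Y)$, $q^R_{X,Y}:X\otimes Y\to X\otimes_RY$ is the coequalizer of $\nu^R_X\otimes\mathrm{Id}_Y$ and $\mathrm{Id}_X\otimes\mu^R_Y$. For $g:X\to X'$ right $R$-linear, $\hat g:X\otimes_RY\to X'\otimes_RY$ is given by $\hat gq^R_{X,Y}=q^R_{X',Y}(g\otimes\mathrm{Id}_Y)$; for $f:Y\to Y'$ left $R$-linear, $\tilde f:X\otimes_RY\to X\otimes_RY'$ is given by $\tilde fq^R_{X,Y}=q^R_{X,Y'}(\mathrm{Id}_X\otimes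 f)$. The isomorphisms $\Upsilon_X:X\otimes_RR\to X$, $\Upsilon'_Y:R\otimes_RY\to Y$ are determined by $\Upsilon_Xq^R_{X,R}=\nu^R_X$, $\Upsilon'_Yq^R_{R,Y}=\mu^R_Y$. A left $R$-module $Y$ is left robust if for all objects $M$ and right $R$-modules $X$ the morphism $\theta'_{M,X,Y}:(M\otimes X)\otimes_RY\to M\otimes(X\otimes_RY)$ with $\theta'_{M,X,Y}q^R_{M\otimes X,Y}=\mathrm{Id}_M\otimes q^R_{X,Y}$ is an isomorphism; ''every object is left robust'' means this for every algebra $R$ and every left $R$-module. Under these hypotheses ${}_R\mathcal{C}_R$ is monoidal with tensor product $\otimes_R$ ($X\otimes_RY$ has $R$-actions induced by the left action on $X$ and the right action on $Y$), unit object $R$, associativity constraint $\Sigma'_{M,X,Y}:(M\otimes_RX)\otimes_RY\to M\otimes_R(X\otimes_RY)$ determined by $\Sigma'_{M,X,Y}q^R_{M\otimes_RX,Y}(q^R_{M,X}\otimes\mathrm{Id}_Y)=q^R_{M,X\otimes_RY}(\mathrm{Id}_M\otimes q^R_{X,Y})$, with inverse $\Gamma'_{M,X,Y}$, and unit constraints $\Upsilon',\Upsilon$. An algebra extension $i:R\to S$ is an algebra morphism; $S$ is an $R$-bimodule via $i$, and is an algebra in ${}_R\mathcal{C}_R$ with unit $i$ and multiplication $m^R_S$ determined by $m^R_Sq^R_{S,S}=m_S$. $S\otimes_RS$ is an $S$-bimodule in $\mathcal{C}$ via $\mu^S_{S\otimes_RS}(\mathrm{Id}_S\otimes q^R_{S,S})=q^R_{S,S}(m_S\otimes\mathrm{Id}_S)$,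 $\nu^S_{S\otimes_RS}(q^R_{S,S}\otimes\mathrm{Id}_S)=q^R_{S,S}(\mathrm{Id}_S\otimes m_S)$. The extension $i$ is Frobenius if there are an $R$-bimodule morphism $\vartheta:S\to R$ and $e:\underline{1}\to S\otimes_RS$ in $\mathcal{C}$ with $\mu^S_{S\otimes_RS}(\mathrm{Id}_S\otimes e)=\nu^S_{S\otimes_RS}(e\otimes\mathrm{Id}_S)$, $\tilde\vartheta e=\Upsilon_S^{-1}\eta_S$, $\hat\vartheta e=\Upsilon'^{-1}_S\eta_S$. The following notions, stated for a monoidal category $(\mathcal{D},\otimes,\underline{1})$ with constraints suppressed, are applied to $({}_R\mathcal{C}_R,\otimes_R,R)$. An adjunction $(\rho,\lambda):Y\dashv X$ consists of $\rho:\underline{1}\to X\otimes Y$, $\lambda:Y\otimes X\to\underline{1}$ with $(\mathrm{Id}_X\otimes\lambda)(\rho\otimes\mathrm{Id}_X)=\mathrm{Id}_X$ and $(\lambda\otimes\mathrm{Id}_Y)(\mathrm{Id}_Y\otimes\rho)=\mathrm{Id}_Y$; then $Y$ is a left dual of $X$ (with $\mathrm{coev}_X=\rho$, $\mathrm{ev}_X=\lambda$) and $X$ is a right dual of $Y$ (with $\mathrm{coev}'_Y=\rho:\underline{1}\to X\otimes Y$, $\mathrm{ev}'_Y=\lambda:Y\otimes X\to\underline{1}$). For an algebra $A$ with left dual $A^*$, $A^*$ is a right $A$-module via $(\mathrm{ev}_A\otimes\mathrm{Id})(\mathrm{Id}\otimes m_A\otimes\mathrm{Id})(\mathrm{Id}\otimes\mathrm{Id}\otimes\mathrm{coev}_A):A^*\otimes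 A\to A^*$; for a right dual ${}^*A$, ${}^*A$ is a left $A$-module via $(\mathrm{Id}\otimes\mathrm{ev}'_A)(\mathrm{Id}\otimes m_A\otimes\mathrm{Id})(\mathrm{coev}'_A\otimes\mathrm{Id}\otimes\mathrm{Id}):A\otimes{}^*A\to{}^*A$. A morphism $B:A\otimes A\to X$ is associative if $B(m_A\otimes\mathrm{Id}_A)=B(\mathrm{Id}_A\otimes m_A)$. An object $P$ is a left $\otimes$-generator if, whenever $f,g:Y\otimes Z\to W$ satisfy $f(\epsilon\otimes\mathrm{Id}_Z)=g(\epsilon\otimes\mathrm{Id}_Z)$ for all $\epsilon:P\to Y$, then $f=g$. A functor is Frobenius if it has a right adjoint which is also a left adjoint. In (ix), $F$ restricts the right $S$-action along $i$, and $X\otimes_RS$ has the right $S$-action induced by $m_S$. *)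

(* Defs.v *)
From Corelib Require Import ssreflect.
From Stdlib Require Import Description ProofIrrelevance.

Set Implicit Arguments.
Unset Strict Implicit.
Unset Printing Implicit Defensive.

Declare Scope cat_scope.
Delimit Scope cat_scope with cat.
Local Open Scope cat_scope.

Record Category : Type := {
  Obj :> Type;
  Hom : Obj -> Obj -> Type;
  idm : forall X : Obj, Hom X X;
  comp : forall X Y Z : Obj, Hom Y Z -> Hom X Y -> Hom X Z;
  compA : forall (W X Y Z : Obj) (h : Hom Y Z) (g : Hom X Y) (f : Hom W X),
    comp h (comp g f) = comp (comp h g) f;
  comp1m : forall (X Y : Obj) (f : Hom X Y), comp (idm Y) f = f;
  compm1 : forall (X Y : Obj) (f : Hom X Y), comp f (idm X) = f
}.

Arguments Hom {_} X Y.
Arguments idm {_} X.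
Arguments comp {_ X Y Z} g f.

Notation "g ∘ f" := (comp g f) (at level 40, left associativity) : cat_scope.

Definition is_iso (C : Category) (X Y : C) (f : Hom X Y) : Prop :=
  exists g : Hom Y X, g ∘ f = idm X /\ f ∘ g = idm Y.

Definition is_coequalizer (C : Category) (X Y Z : C) (f g : Hom X Y)
    (q : Hom Y Z) : Prop :=
  q ∘ f = q ∘ g /\
  forall (W : C) (h : Hom Y W), h ∘ f = h ∘ g -> exists! k : Hom Z W, k ∘ q = h.

Record Coequalizers (C : Category) : Type := {
  coeq : forall (X Y : C) (f g : Hom X Y), C;
  coeq_map : forall (X Y : C) (f g : Hom X Y), Hom Y (coeq f g);
  coeqP : forall (X Y : C) (f g : Hom X Y), is_coequalizer f g (coeq_map f g)
}.

Record Functor (C D : Category) : Type := {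
  fobj :> C -> D;
  fmap : forall X Y : C, Hom X Y -> Hom (fobj X) (fobj Y);
  fmap1 : forall X : C, fmap (idm X) = idm (fobj X);
  fmapM : forall (X Y Z : C) (g : Hom Y Z) (f : Hom X Y),
    fmap (g ∘ f) = fmap g ∘ fmap f
}.

Arguments fmap {C D} F {X Y} f : rename.

(** [F] is a left adjoint of [G]. *)
Definition adjoint_functors (C D : Category) (F : Functor C D) (G : Functor D C)
    : Prop :=
  exists (eta : forall X : C, Hom X (G (F X))) (eps : forall Y : D, Hom (F (G Y)) Y),
    (forall (X X' : C) (f : Hom X X'), fmap G (fmap F f) ∘ eta X = eta X' ∘ f) /\
    (forall (Y Y' : D) (g : Hom Y Y'), g ∘ eps Y = eps Y' ∘ fmap F (fmap G g)) /\
    (forall X : C, eps (F X) ∘ fmap F (eta X) = idm (F X)) /\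
    (forall Y : D, fmap G (eps Y) ∘ eta (G Y) = idm (G Y)).

Definition frobenius_functor (C D : Category) (F : Functor C D) : Prop :=
  exists G : Functor D C, adjoint_functors F G /\ adjoint_functors G F.

(** The constraints are explicit: a strict category is the case where they are
    identities, and formulas usually written in a strict category get the
    coherence isomorphisms inserted. *)
Record MonoidalCategory : Type := {
  mcat :> Category;
  tobj : mcat -> mcat -> mcat;
  thom : forall X X' Y Y' : mcat,
    Hom X X' -> Hom Y Y' -> Hom (tobj X Y) (tobj X' Y');
  unit : mcat;
  assoc : forall X Y Z : mcat, Hom (tobj (tobj X Y) Z) (tobj X (tobj Y Z));
  assoc_inv : forall X Y Z : mcat, Hom (tobj X (tobj Y Z)) (tobj (tobj X Y) Z);
  lunit : forall X : mcat, Hom (tobj unit X) X;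
  lunit_inv : forall X : mcat, Hom X (tobj unit X);
  runit : forall X : mcat, Hom (tobj X unit) X;
  runit_inv : forall X : mcat, Hom X (tobj X unit);
  thom1 : forall X Y : mcat, thom (idm X) (idm Y) = idm (tobj X Y);
  thomM : forall (X X' X'' Y Y' Y'' : mcat) (f' : Hom X' X'') (f : Hom X X')
      (g' : Hom Y' Y'') (g : Hom Y Y'),
    thom (f' ∘ f) (g' ∘ g) = thom f' g' ∘ thom f g;
  assocK : forall X Y Z : mcat, assoc_inv X Y Z ∘ assoc X Y Z = idm _;
  assocVK : forall X Y Z : mcat, assoc X Y Z ∘ assoc_inv X Y Z = idm _;
  lunitK : forall X : mcat, lunit_inv X ∘ lunit X = idm _;
  lunitVK : forall X : mcat, lunit X ∘ lunit_inv X = idm _;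
  runitK : forall X : mcat, runit_inv X ∘ runit X = idm _;
  runitVK : forall X : mcat, runit X ∘ runit_inv X = idm _;
  assocN : forall (X X' Y Y' Z Z' : mcat) (f : Hom X X') (g : Hom Y Y')
      (h : Hom Z Z'),
    assoc X' Y' Z' ∘ thom (thom f g) h = thom f (thom g h) ∘ assoc X Y Z;
  lunitN : forall (X X' : mcat) (f : Hom X X'),
    lunit X' ∘ thom (idm unit) f = f ∘ lunit X;
  runitN : forall (X X' : mcat) (f : Hom X X'),
    runit X' ∘ thom f (idm unit) = f ∘ runit X;
  pentagon : forall W X Y Z : mcat,
    assoc W X (tobj Y Z) ∘ assoc (tobj W X) Y Z =
    thom (idm W) (assoc X Y Z) ∘ (assoc W (tobj X Y) Z
      ∘ thom (assoc W X Y) (idm Z));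
  triangle : forall X Y : mcat,
    thom (idm X) (lunit Y) ∘ assoc X unit Y = thom (runit X) (idm Y)
}.

Arguments tobj {_} X Y.
Arguments thom {_ X X' Y Y'} f g.
Arguments unit {_}.
Arguments assoc {_} X Y Z.
Arguments assoc_inv {_} X Y Z.
Arguments lunit {_} X.
Arguments lunit_inv {_} X.
Arguments runit {_} X.
Arguments runit_inv {_} X.

Notation "X ⊗ Y" := (tobj X Y) (at level 36, left associativity) : cat_scope.
Notation "f ⊠ g" := (thom f g) (at level 36, left associativity) : cat_scope.

Definition coflat (C : MonoidalCategory) (M : C) : Prop :=
  forall (X Y Z : C) (f g : Hom X Y) (q : Hom Y Z), is_coequalizer f g q ->
    is_coequalizer (idm M ⊠ f) (idm M ⊠ g) (idm M ⊠ q) /\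
    is_coequalizer (f ⊠ idm M) (g ⊠ idm M) (q ⊠ idm M).

Definition left_tensor_generator (C : MonoidalCategory) (P : C) : Prop :=
  forall (Y Z W : C) (f g : Hom (Y ⊗ Z) W),
    (forall e : Hom P Y, f ∘ (e ⊠ idm Z) = g ∘ (e ⊠ idm Z)) -> f = g.

(** [(rho, lam) : Y ⊣ X]. *)
Definition is_adjunction (C : MonoidalCategory) (Y X : C)
    (rho : Hom unit (X ⊗ Y)) (lam : Hom (Y ⊗ X) unit) : Prop :=
  runit X ∘ (idm X ⊠ lam) ∘ assoc X Y X ∘ (rho ⊠ idm X) ∘ lunit_inv X = idm X /\
  lunit Y ∘ (lam ⊠ idm Y) ∘ assoc_inv Y X Y ∘ (idm Y ⊠ rho) ∘ runit_inv Y = idm Y.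

Record Alg (C : MonoidalCategory) : Type := {
  alg_obj :> C;
  mul : Hom (alg_obj ⊗ alg_obj) alg_obj;
  one : Hom unit alg_obj;
  mulA : mul ∘ (mul ⊠ idm alg_obj) = mul ∘ (idm alg_obj ⊠ mul) ∘ assoc _ _ _;
  mul1a : mul ∘ (one ⊠ idm alg_obj) = lunit alg_obj;
  mula1 : mul ∘ (idm alg_obj ⊠ one) = runit alg_obj
}.

Arguments mul {_} A : rename.
Arguments one {_} A : rename.

Record AlgHom (C : MonoidalCategory) (A B : Alg C) : Type := {
  alg_map :> Hom A B;
  alg_mapM : alg_map ∘ mul A = mul B ∘ (alg_map ⊠ alg_map);
  alg_map1 : alg_map ∘ one A = one B
}.

Record LMod (C : MonoidalCategory) (A : Alg C) : Type := {
  lmod_obj :> C;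
  lact : Hom (A ⊗ lmod_obj) lmod_obj;
  lactA : lact ∘ (mul A ⊠ idm lmod_obj) = lact ∘ (idm A ⊠ lact) ∘ assoc _ _ _;
  lact1 : lact ∘ (one A ⊠ idm lmod_obj) = lunit lmod_obj
}.

Record RMod (C : MonoidalCategory) (A : Alg C) : Type := {
  rmod_obj :> C;
  ract : Hom (rmod_obj ⊗ A) rmod_obj;
  ractA : ract ∘ (ract ⊠ idm A) = ract ∘ (idm rmod_obj ⊠ mul A) ∘ assoc _ _ _;
  ract1 : ract ∘ (idm rmod_obj ⊠ one A) = runit rmod_obj
}.

Arguments lact {C A} X : rename.
Arguments ract {C A} X : rename.

Record Bim (C : MonoidalCategory) (A B : Alg C) : Type := {
  bim_obj :> C;
  bim_lact : Hom (A ⊗ bim_obj) bim_obj;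
  bim_ract : Hom (bim_obj ⊗ B) bim_obj;
  bim_lactA : bim_lact ∘ (mul A ⊠ idm bim_obj)
    = bim_lact ∘ (idm A ⊠ bim_lact) ∘ assoc _ _ _;
  bim_lact1 : bim_lact ∘ (one A ⊠ idm bim_obj) = lunit bim_obj;
  bim_ractA : bim_ract ∘ (bim_ract ⊠ idm B)
    = bim_ract ∘ (idm bim_obj ⊠ mul B) ∘ assoc _ _ _;
  bim_ract1 : bim_ract ∘ (idm bim_obj ⊠ one B) = runit bim_obj;
  bim_lract : bim_ract ∘ (bim_lact ⊠ idm B)
    = bim_lact ∘ (idm A ⊠ bim_ract) ∘ assoc _ _ _
}.

Arguments bim_lact {C A B} X : rename.
Arguments bim_ract {C A B} X : rename.

Definition bim_l (C : MonoidalCategory) (A B : Alg C) (X : Bim A B) : LMod A :=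
  {| lmod_obj := X; lact := bim_lact X; lactA := bim_lactA X; lact1 := bim_lact1 X |}.

Definition bim_r (C : MonoidalCategory) (A B : Alg C) (X : Bim A B) : RMod B :=
  {| rmod_obj := X; ract := bim_ract X; ractA := bim_ractA X; ract1 := bim_ract1 X |}.

Record BimHom (C : MonoidalCategory) (A B : Alg C) (X Y : Bim A B) : Type := {
  bim_map :> Hom (X : C) (Y : C);
  bim_mapl : bim_map ∘ bim_lact X = bim_lact Y ∘ (idm A ⊠ bim_map);
  bim_mapr : bim_map ∘ bim_ract X = bim_ract Y ∘ (bim_map ⊠ idm B)
}.

Record LeftDual (C : MonoidalCategory) (X : C) : Type := {
  ldual :> C;
  coev : Hom unit (X ⊗ ldual);
  ev : Hom (ldual ⊗ X) unit;
  ldualP : is_adjunction (Y := ldual) (X := X) coev ev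
}.

Record RightDual (C : MonoidalCategory) (Y : C) : Type := {
  rdual :> C;
  coev' : Hom unit (rdual ⊗ Y);
  ev' : Hom (Y ⊗ rdual) unit;
  rdualP : is_adjunction (Y := Y) (X := rdual) coev' ev'
}.

Section Forms.
Variables (C : MonoidalCategory) (A : Alg C).

Definition ldual_ract (d : LeftDual A) : Hom (d ⊗ A) d :=
  lunit d ∘ (ev d ⊠ idm (d : C)) ∘ ((idm (d : C) ⊠ mul A) ⊠ idm (d : C))
  ∘ (assoc d A A ⊠ idm (d : C)) ∘ assoc_inv (d ⊗ A) A d
  ∘ (idm (d ⊗ A) ⊠ coev d) ∘ runit_inv (d ⊗ A).

Definition rdual_lact (d : RightDual A) : Hom (A ⊗ d) d :=
  runit d ∘ (idm (d : C) ⊠ ev' d) ∘ (idm (d : C) ⊠ (mul A ⊠ idm (d : C)))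
  ∘ (idm (d : C) ⊠ assoc_inv A A d) ∘ assoc d A (A ⊗ d)
  ∘ (coev' d ⊠ idm (A ⊗ d)) ∘ lunit_inv (A ⊗ d).

(** Only the two actions are compared, so no proof of the module laws is carried. *)
Definition right_modules_isomorphic (X Y : C) (nuX : Hom (X ⊗ A) X)
    (nuY : Hom (Y ⊗ A) Y) : Prop :=
  exists f : Hom X Y, is_iso f /\ f ∘ nuX = nuY ∘ (f ⊠ idm (A : C)).

Definition left_modules_isomorphic (X Y : C) (muX : Hom (A ⊗ X) X)
    (muY : Hom (A ⊗ Y) Y) : Prop :=
  exists f : Hom X Y, is_iso f /\ f ∘ muX = muY ∘ (idm (A : C) ⊠ f).

Definition associative (X : C) (B : Hom (A ⊗ A) X) : Prop :=
  B ∘ (mul A ⊠ idm (A : C)) = B ∘ (idm (A : C) ⊠ mul A) ∘ assoc A A A.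

Definition Phi_r (d : RightDual A) (B : Hom (A ⊗ A) unit) : Hom A d :=
  runit d ∘ (idm (d : C) ⊠ B) ∘ assoc d A A ∘ (coev' d ⊠ idm (A : C)) ∘ lunit_inv A.

Definition Phi_l (d : LeftDual A) (B : Hom (A ⊗ A) unit) : Hom A d :=
  lunit d ∘ (B ⊠ idm (d : C)) ∘ assoc_inv A A d ∘ (idm (A : C) ⊠ coev d) ∘ runit_inv A.

Definition is_coalgebra (X : C) (delta : Hom X (X ⊗ X)) (eps : Hom X unit) : Prop :=
  assoc X X X ∘ (delta ⊠ idm X) ∘ delta = (idm X ⊠ delta) ∘ delta /\
  lunit X ∘ (eps ⊠ idm X) ∘ delta = idm X /\
  runit X ∘ (idm X ⊠ eps) ∘ delta = idm X.

(** [A]-bilinearity of a comultiplication, [A ⊗ A] being an [A]-bimodule through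
    the outer factors. *)
Definition bilinear_comul (delta : Hom A (A ⊗ A)) : Prop :=
  delta ∘ mul A
    = (mul A ⊠ idm (A : C)) ∘ assoc_inv A A A ∘ (idm (A : C) ⊠ delta) /\
  delta ∘ mul A
    = (idm (A : C) ⊠ mul A) ∘ assoc A A A ∘ (delta ⊠ idm (A : C)).

End Forms.

Lemma comp_pre (C : Category) (W X Y Z : C) (f : Hom Y Z) (g : Hom X Y)
    (h : Hom X Z) : f ∘ g = h -> forall k : Hom W X, f ∘ (g ∘ k) = h ∘ k.
Proof. by move=> <- k; rewrite compA. Qed.

Lemma comp_pre2 (C : Category) (W X Y Y' Z : C) (f : Hom Y Z) (g : Hom X Y)
    (f' : Hom Y' Z) (g' : Hom X Y') :
  f ∘ g = f' ∘ g' -> forall k : Hom W X, f ∘ (g ∘ k) = f' ∘ (g' ∘ k).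
Proof. by move=> E k; rewrite !compA E. Qed.

Lemma comp_pre3 (C : Category) (V W X Y Z : C) (f : Hom Y Z) (g : Hom X Y)
    (h : Hom W X) (e : Hom W Z) :
  f ∘ (g ∘ h) = e -> forall k : Hom V W, f ∘ (g ∘ (h ∘ k)) = e ∘ k.
Proof. by move=> <- k; rewrite !compA. Qed.

Lemma split_epi (C : Category) (X Y Z : C) (f : Hom X Y) (g : Hom Y X) :
  f ∘ g = idm Y -> forall h k : Hom Y Z, h ∘ f = k ∘ f -> h = k.
Proof. by move=> E h k H; rewrite -(compm1 h) -(compm1 k) -E !compA H. Qed.

Lemma split_mono (C : Category) (X Y Z : C) (f : Hom X Y) (g : Hom Y X) :
  g ∘ f = idm X -> forall h k : Hom Z X, f ∘ h = f ∘ k -> h = k.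
Proof. by move=> E h k H; rewrite -(comp1m h) -(comp1m k) -E -!compA H. Qed.

Section Coeq.
Variables (C : Category) (X Y Z : C) (f g : Hom X Y) (q : Hom Y Z).
Hypothesis Hq : is_coequalizer f g q.

Definition coeq_desc (W : C) (h : Hom Y W) (E : h ∘ f = h ∘ g) : Hom Z W :=
  proj1_sig (constructive_definite_description _ (proj2 Hq W h E)).

Lemma coeq_descE (W : C) (h : Hom Y W) (E : h ∘ f = h ∘ g) : coeq_desc E ∘ q = h.
Proof. by rewrite /coeq_desc; case: (constructive_definite_description _ _). Qed.

Lemma coeq_epi (W : C) (h k : Hom Z W) : h ∘ q = k ∘ q -> h = k.
Proof.
move=> E.
have Eh : (h ∘ q) ∘ f = (h ∘ q) ∘ g by rewrite -!compA (proj1 Hq).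
have [r [_ Ur]] := proj2 Hq W (h ∘ q) Eh.
by rewrite -(Ur h eq_refl) -(Ur k (eq_sym E)).
Qed.

End Coeq.

Section Monoidal.
Variable C : MonoidalCategory.
Implicit Types X Y Z W : C.

Lemma thomL X Y Y' Y'' (g' : Hom Y' Y'') (g : Hom Y Y') :
  idm X ⊠ (g' ∘ g) = (idm X ⊠ g') ∘ (idm X ⊠ g).
Proof. by rewrite -thomM comp1m. Qed.

Lemma thomR Y X X' X'' (g' : Hom X' X'') (g : Hom X X') :
  (g' ∘ g) ⊠ idm Y = (g' ⊠ idm Y) ∘ (g ⊠ idm Y).
Proof. by rewrite -thomM comp1m. Qed.

Lemma thomLR X X' Y Y' (f : Hom X X') (g : Hom Y Y') :
  f ⊠ g = (idm X' ⊠ g) ∘ (f ⊠ idm Y).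
Proof. by rewrite -thomM comp1m compm1. Qed.

Lemma thomRL X X' Y Y' (f : Hom X X') (g : Hom Y Y') :
  f ⊠ g = (f ⊠ idm Y') ∘ (idm X ⊠ g).
Proof. by rewrite -thomM comp1m compm1. Qed.

Lemma thom_swap X X' Y Y' (f : Hom X X') (g : Hom Y Y') :
  (f ⊠ idm Y') ∘ (idm X ⊠ g) = (idm X' ⊠ g) ∘ (f ⊠ idm Y).
Proof. by rewrite -thomLR -thomRL. Qed.

Lemma assoc_epi X Y Z W (h k : Hom (X ⊗ (Y ⊗ Z)) W) :
  h ∘ assoc X Y Z = k ∘ assoc X Y Z -> h = k.
Proof. exact: split_epi (assocVK _ _ _) _ _. Qed.

Lemma assoc_mono X Y Z W (h k : Hom W ((X ⊗ Y) ⊗ Z)) :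
  assoc X Y Z ∘ h = assoc X Y Z ∘ k -> h = k.
Proof. exact: split_mono (assocK _ _ _) _ _. Qed.

Lemma assoc_invN X X' Y Y' Z Z' (f : Hom X X') (g : Hom Y Y') (h : Hom Z Z') :
  assoc_inv X' Y' Z' ∘ (f ⊠ (g ⊠ h)) = ((f ⊠ g) ⊠ h) ∘ assoc_inv X Y Z.
Proof.
apply: assoc_mono; apply: assoc_epi.
by rewrite -!compA assocK compm1 assocN (comp_pre (assocVK _ _ _)) comp1m.
Qed.

Lemma assoc_invNR X Y Z Z' (h : Hom Z Z') :
  assoc_inv X Y Z' ∘ (idm X ⊠ (idm Y ⊠ h)) = (idm (X ⊗ Y) ⊠ h) ∘ assoc_inv X Y Z.
Proof. by rewrite assoc_invN thom1. Qed.

Lemma assoc_invNL X X' Y Z (h : Hom X X') :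
  assoc_inv X' Y Z ∘ (h ⊠ idm (Y ⊗ Z)) = ((h ⊠ idm Y) ⊠ idm Z) ∘ assoc_inv X Y Z.
Proof. by rewrite -thom1 assoc_invN. Qed.

Lemma assocNR X Y Z Z' (h : Hom Z Z') :
  assoc X Y Z' ∘ (idm (X ⊗ Y) ⊠ h) = (idm X ⊠ (idm Y ⊠ h)) ∘ assoc X Y Z.
Proof. by rewrite -thom1 assocN. Qed.

Lemma assocNL X X' Y Z (h : Hom X X') :
  assoc X' Y Z ∘ ((h ⊠ idm Y) ⊠ idm Z) = (h ⊠ idm (Y ⊗ Z)) ∘ assoc X Y Z.
Proof. by rewrite -thom1 assocN. Qed.

Lemma pentagon1 W X Y Z :
  assoc_inv W (X ⊗ Y) Z ∘ (idm W ⊠ assoc_inv X Y Z) ∘ assoc W X (Y ⊗ Z)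
  = (assoc W X Y ⊠ idm Z) ∘ assoc_inv (W ⊗ X) Y Z.
Proof.
apply: (@assoc_mono W (X ⊗ Y) Z).
apply: (split_mono (f := idm W ⊠ assoc X Y Z) (g := idm W ⊠ assoc_inv X Y Z)).
  by rewrite -thomL assocK thom1.
rewrite -!compA (comp_pre (assocVK _ _ _)) comp1m.
rewrite compA -thomL assocVK thom1 comp1m.
apply: assoc_epi.
by rewrite pentagon -!compA assocK compm1.
Qed.

Lemma pentagon2 W X Y Z :
  (assoc_inv W X Y ⊠ idm Z) ∘ assoc_inv W (X ⊗ Y) Z ∘ (idm W ⊠ assoc_inv X Y Z)
  = assoc_inv (W ⊗ X) Y Z ∘ assoc_inv W X (Y ⊗ Z).
Proof.
apply: assoc_epi.
have E := pentagon1 W X Y Z; rewrite -!compA in E.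
by rewrite -!compA E assocK compm1 compA -thomR assocK thom1 comp1m.
Qed.

Lemma pentagon3 W X Y Z :
  assoc (W ⊗ X) Y Z ∘ (assoc_inv W X Y ⊠ idm Z) ∘ assoc_inv W (X ⊗ Y) Z
  = assoc_inv W X (Y ⊗ Z) ∘ (idm W ⊠ assoc X Y Z).
Proof.
apply: (split_epi (f := idm W ⊠ assoc_inv X Y Z) (g := idm W ⊠ assoc X Y Z)).
  by rewrite -thomL assocK thom1.
have E := pentagon2 W X Y Z; rewrite -!compA in E.
by rewrite -!compA E -thomL assocVK thom1 compm1 compA assocVK comp1m.
Qed.

Lemma pentagon4 W X Y Z :
  assoc (W ⊗ X) Y Z ∘ (assoc_inv W X Y ⊠ idm Z)
  = assoc_inv W X (Y ⊗ Z) ∘ (idm W ⊠ assoc X Y Z) ∘ assoc W (X ⊗ Y) Z.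
Proof. by rewrite -pentagon3 -!compA assocK compm1. Qed.

Lemma pentagon5 W X Y Z :
  (idm W ⊠ assoc_inv X Y Z) ∘ assoc W X (Y ⊗ Z) ∘ assoc (W ⊗ X) Y Z
  = assoc W (X ⊗ Y) Z ∘ (assoc W X Y ⊠ idm Z).
Proof. by rewrite -compA pentagon compA -thomL assocK thom1 comp1m. Qed.

Lemma lunit_assoc X Y : lunit (X ⊗ Y) ∘ assoc unit X Y = lunit X ⊠ idm Y.
Proof.
have faith W W' (f g : Hom W W') : idm unit ⊠ f = idm unit ⊠ g -> f = g.
  move=> E; apply: (split_epi (lunitVK W)).
  by rewrite -!lunitN E.
apply: faith; rewrite thomL.
apply: (split_epi (assocVK unit (unit ⊗ X) Y)).
apply: (split_epi (f := assoc unit unit X ⊠ idm Y)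
                  (g := assoc_inv unit unit X ⊠ idm Y)).
  by rewrite -thomR assocVK thom1.
rewrite -!compA -pentagon compA triangle -assocNL -triangle thomR.
by rewrite compA assocN -compA.
Qed.

Lemma runit_assoc X Y : (idm X ⊠ runit Y) ∘ assoc X Y unit = runit (X ⊗ Y).
Proof.
have faith W W' (f g : Hom W W') : f ⊠ idm unit = g ⊠ idm unit -> f = g.
  move=> E; apply: (split_epi (runitVK W)).
  by rewrite -!runitN E.
apply: faith; rewrite thomR.
apply: assoc_mono.
rewrite -triangle.
rewrite (comp_pre (assocN _ _ _)) -!compA.
rewrite -(triangle Y unit) thomL -!compA -pentagon.
by rewrite (comp_pre2 (assocNR _ _ _)).
Qed.

End Monoidal.

Lemma bimhom_ext (C : MonoidalCategory) (A B : Alg C) (X Y : Bim A B)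
    (f g : BimHom X Y) : bim_map f = bim_map g -> f = g.
Proof.
case: f g => [f fl fr] [g gl gr] /= E; case: g / E gl gr => gl gr.
by rewrite (proof_irrelevance _ fl gl) (proof_irrelevance _ fr gr).
Qed.

#[local] Obligation Tactic := idtac.

Section BimCat.
Variables (C : MonoidalCategory) (A B : Alg C).

Program Definition bimhom_id (X : Bim A B) : BimHom X X := {| bim_map := idm (X : C) |}.
Next Obligation. by move=> X; rewrite thom1 comp1m compm1. Qed.
Next Obligation. by move=> X; rewrite thom1 comp1m compm1. Qed.

Program Definition bimhom_comp (X Y Z : Bim A B) (g : BimHom Y Z) (f : BimHom X Y)
  : BimHom X Z := {| bim_map := g ∘ f |}.
Next Obligation.
by move=> X Y Z g f; rewrite thomL -compA bim_mapl compA bim_mapl compA.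
Qed.
Next Obligation.
by move=> X Y Z g f; rewrite thomR -compA bim_mapr compA bim_mapr compA.
Qed.

Definition bimhom_inv (X Y : Bim A B) (f : BimHom X Y) (g : Hom (Y : C) (X : C))
  (fK : g ∘ f = idm (X : C)) (gK : f ∘ g = idm (Y : C)) : BimHom Y X.
Proof.
refine {| bim_map := g |}.
- apply: (split_mono fK); rewrite compA gK comp1m compA bim_mapl.
  by rewrite -compA -thomL gK thom1 compm1.
- apply: (split_mono fK); rewrite compA gK comp1m compA bim_mapr.
  by rewrite -compA -thomR gK thom1 compm1.
Defined.

Program Definition bim_cat : Category := {|
  Obj := Bim A B;
  Hom := fun X Y => BimHom X Y;
  idm := bimhom_id;
  comp := bimhom_comp
|}.
Next Obligation. by move=> *; apply: bimhom_ext; apply: compA. Qed.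
Next Obligation. by move=> *; apply: bimhom_ext; apply: comp1m. Qed.
Next Obligation. by move=> *; apply: bimhom_ext; apply: compm1. Qed.

End BimCat.

Program Definition reg_bim (C : MonoidalCategory) (A : Alg C) : Bim A A :=
  {| bim_obj := A; bim_lact := mul A; bim_ract := mul A |}.
Next Obligation. by move=> C A; apply: mulA. Qed.
Next Obligation. by move=> C A; apply: mul1a. Qed.
Next Obligation. by move=> C A; apply: mulA. Qed.
Next Obligation. by move=> C A; apply: mula1. Qed.
Next Obligation. by move=> C A; apply: mulA. Qed.

Section Restriction.
Variables (C : MonoidalCategory) (R S : Alg C) (i : AlgHom R S).

Program Definition restrl (B : Alg C) (X : Bim S B) : Bim R B :=
  {| bim_obj := X; bim_lact := bim_lact X ∘ (i ⊠ idm (X : C));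
     bim_ract := bim_ract X |}.
Next Obligation.
move=> B X; rewrite -compA -thomR alg_mapM thomR compA bim_lactA -!compA.
rewrite assocN (comp_pre2 (thom_swap _ _)) thomL -!compA.
by rewrite (comp_pre (eq_sym (thomLR _ _))).
Qed.
Next Obligation.
by move=> B X; rewrite -compA -thomR alg_map1 bim_lact1.
Qed.
Next Obligation. by move=> B X; apply: bim_ractA. Qed.
Next Obligation. by move=> B X; apply: bim_ract1. Qed.
Next Obligation.
move=> B X; rewrite thomR compA bim_lract -!compA; congr (_ ∘ _).
by rewrite assocNL (comp_pre2 (thom_swap _ _)).
Qed.

Program Definition restrr (A : Alg C) (X : Bim A S) : Bim A R :=
  {| bim_obj := X; bim_lact := bim_lact X;
     bim_ract := bim_ract X ∘ (idm (X : C) ⊠ i) |}.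
Next Obligation. by move=> A X; apply: bim_lactA. Qed.
Next Obligation. by move=> A X; apply: bim_lact1. Qed.
Next Obligation.
move=> A X; rewrite thomR -!compA (comp_pre2 (eq_sym (thom_swap _ _))).
rewrite compA bim_ractA -!compA -(thomLR (idm (X : C) ⊠ i)) assocN.
by rewrite !(comp_pre (eq_sym (thomL _ _ _))) alg_mapM.
Qed.
Next Obligation.
by move=> A X; rewrite -compA -thomL alg_map1 bim_ract1.
Qed.
Next Obligation.
move=> A X; rewrite thomL -!compA -thom_swap compA bim_lract -!compA.
by rewrite assocNR.
Qed.

Program Definition restrr_hom (A : Alg C) (X Y : Bim A S) (f : BimHom X Y) :
  BimHom (restrr X) (restrr Y) := {| bim_map := bim_map f |}.
Next Obligation. by move=> A X Y f; apply: (bim_mapl f). Qed.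
Next Obligation.
by move=> A X Y f /=; rewrite compA bim_mapr -!compA thom_swap.
Qed.

Program Definition restrr_functor (A : Alg C) : Functor (bim_cat A S) (bim_cat A R) :=
  {| fobj := @restrr A : bim_cat A S -> bim_cat A R; fmap := @restrr_hom A |}.
Next Obligation. by move=> A X; apply: bimhom_ext. Qed.
Next Obligation. by move=> A X Y Z g f; apply: bimhom_ext. Qed.

End Restriction.

Section TensorObject.
Variables (C : MonoidalCategory) (Q : Coequalizers C) (R : Alg C).

Definition tens (X : RMod R) (Y : LMod R) : C :=
  coeq Q (ract X ⊠ idm (Y : C)) ((idm (X : C) ⊠ lact Y) ∘ assoc X R Y).

Definition tens_q (X : RMod R) (Y : LMod R) : Hom (X ⊗ Y) (tens X Y) :=
  coeq_map Q (ract X ⊠ idm (Y : C)) ((idm (X : C) ⊠ lact Y) ∘ assoc X R Y).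

Lemma tens_qP (X : RMod R) (Y : LMod R) :
  is_coequalizer (ract X ⊠ idm (Y : C)) ((idm (X : C) ⊠ lact Y) ∘ assoc X R Y)
    (tens_q X Y).
Proof. exact: coeqP. Qed.

Lemma tens_bal (X : RMod R) (Y : LMod R) :
  tens_q X Y ∘ (ract X ⊠ idm (Y : C))
  = tens_q X Y ∘ ((idm (X : C) ⊠ lact Y) ∘ assoc X R Y).
Proof. exact: (proj1 (tens_qP X Y)). Qed.

Lemma tens_epi (X : RMod R) (Y : LMod R) (W : C) (h k : Hom (tens X Y) W) :
  h ∘ tens_q X Y = k ∘ tens_q X Y -> h = k.
Proof. exact: coeq_epi (tens_qP X Y) _ _ _. Qed.

Program Definition tensor_rmod (M : C) (X : RMod R) : RMod R :=
  {| rmod_obj := M ⊗ X; ract := (idm M ⊠ ract X) ∘ assoc M X R |}.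
Next Obligation.
move=> M X; rewrite thomR -!compA (comp_pre2 (assocN _ _ _)).
rewrite (comp_pre (eq_sym (thomL _ _ _))) ractA !thomL -!compA -pentagon.
by rewrite (comp_pre2 (assocNR _ _ _)).
Qed.
Next Obligation.
by move=> M X; rewrite -compA assocNR compA -thomL ract1 runit_assoc.
Qed.

Lemma theta_bal (M : C) (X : RMod R) (Y : LMod R) :
  (idm M ⊠ tens_q X Y) ∘ assoc M X Y ∘ (ract (tensor_rmod M X) ⊠ idm (Y : C))
  = (idm M ⊠ tens_q X Y) ∘ assoc M X Y
    ∘ ((idm (tensor_rmod M X : C) ⊠ lact Y) ∘ assoc _ R Y).
Proof.
rewrite /= thomR -!compA (comp_pre2 (assocN _ _ _)).
rewrite (comp_pre2 (assocNR _ _ _)) pentagon.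
by rewrite !(comp_pre (eq_sym (thomL _ _ _))) tens_bal -!compA.
Qed.

(** θ' *)
Definition theta (M : C) (X : RMod R) (Y : LMod R) :
    Hom (tens (tensor_rmod M X) Y) (M ⊗ tens X Y) :=
  coeq_desc (tens_qP (tensor_rmod M X) Y) (theta_bal M X Y).

Definition left_robust (Y : LMod R) : Prop :=
  forall (M : C) (X : RMod R), is_iso (theta M X Y).

End TensorObject.

Section TensorBim.
Variables (C : MonoidalCategory) (Q : Coequalizers C).
Hypothesis flat : forall M : C, coflat M.

Section Product.
Variables (A R B : Alg C) (X : Bim A R) (Y : Bim R B).

Local Notation q := (tens_q Q (bim_r X) (bim_l Y)).

Lemma tens_qPl (Z : C) :
  is_coequalizer (idm Z ⊠ (bim_ract X ⊠ idm (Y : C)))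
    (idm Z ⊠ ((idm (X : C) ⊠ bim_lact Y) ∘ assoc X R Y)) (idm Z ⊠ q).
Proof. exact: (proj1 (flat Z (tens_qP Q (bim_r X) (bim_l Y)))). Qed.

Lemma tens_qPr (Z : C) :
  is_coequalizer ((bim_ract X ⊠ idm (Y : C)) ⊠ idm Z)
    (((idm (X : C) ⊠ bim_lact Y) ∘ assoc X R Y) ⊠ idm Z) (q ⊠ idm Z).
Proof. exact: (proj2 (flat Z (tens_qP Q (bim_r X) (bim_l Y)))). Qed.

Lemma bim_bal : q ∘ (bim_ract X ⊠ idm (Y : C))
  = q ∘ ((idm (X : C) ⊠ bim_lact Y) ∘ assoc X R Y).
Proof. exact: (tens_bal Q (bim_r X) (bim_l Y)). Qed.

Lemma bim_lractV :
  bim_lact X ∘ (idm (A : C) ⊠ bim_ract X)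
  = bim_ract X ∘ (bim_lact X ⊠ idm (R : C)) ∘ assoc_inv _ _ _.
Proof. by rewrite bim_lract -!compA assocVK compm1. Qed.

Lemma bim_lact_bal :
  (q ∘ (bim_lact X ⊠ idm (Y : C)) ∘ assoc_inv A X Y)
    ∘ (idm (A : C) ⊠ (bim_ract X ⊠ idm (Y : C)))
  = (q ∘ (bim_lact X ⊠ idm (Y : C)) ∘ assoc_inv A X Y)
    ∘ (idm (A : C) ⊠ ((idm (X : C) ⊠ bim_lact Y) ∘ assoc X R Y)).
Proof.
rewrite -!compA assoc_invN (comp_pre (eq_sym (thomR _ _ _))) bim_lractV !thomR.
rewrite -!compA (comp_pre2 bim_bal) -!compA (comp_pre2 (assocNL _ _ _)).
have E := pentagon3 A X R Y; rewrite -!compA in E; rewrite E thomL.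
by rewrite (comp_pre2 (assoc_invNR _ _ _)) (comp_pre2 (thom_swap _ _)).
Qed.

Definition tens_lact : Hom (A ⊗ tens Q (bim_r X) (bim_l Y)) (tens Q (bim_r X) (bim_l Y)) :=
  coeq_desc (tens_qPl A) bim_lact_bal.

Lemma tens_lactE :
  tens_lact ∘ (idm (A : C) ⊠ q) = q ∘ (bim_lact X ⊠ idm (Y : C)) ∘ assoc_inv A X Y.
Proof. exact: coeq_descE. Qed.

Lemma bim_ract_bal :
  (q ∘ (idm (X : C) ⊠ bim_ract Y) ∘ assoc X Y B)
    ∘ ((bim_ract X ⊠ idm (Y : C)) ⊠ idm (B : C))
  = (q ∘ (idm (X : C) ⊠ bim_ract Y) ∘ assoc X Y B)
    ∘ (((idm (X : C) ⊠ bim_lact Y) ∘ assoc X R Y) ⊠ idm (B : C)).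
Proof.
rewrite -!compA assocNL (comp_pre2 (eq_sym (thom_swap _ _))).
rewrite (comp_pre2 bim_bal) -!compA (comp_pre2 (assocNR _ _ _)) thomR.
rewrite (comp_pre2 (assocN _ _ _)) pentagon.
by rewrite !(comp_pre (eq_sym (thomL _ _ _))) bim_lract !thomL -!compA.
Qed.

Definition tens_ract : Hom (tens Q (bim_r X) (bim_l Y) ⊗ B) (tens Q (bim_r X) (bim_l Y)) :=
  coeq_desc (tens_qPr B) bim_ract_bal.

Lemma tens_ractE :
  tens_ract ∘ (q ⊠ idm (B : C)) = q ∘ (idm (X : C) ⊠ bim_ract Y) ∘ assoc X Y B.
Proof. exact: coeq_descE. Qed.

Program Definition tens_bim : Bim A B := {|
  bim_obj := tens Q (bim_r X) (bim_l Y);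
  bim_lact := tens_lact;
  bim_ract := tens_ract
|}.
Next Obligation.
apply: (coeq_epi (tens_qPl (A ⊗ A))).
rewrite -!compA thom_swap assocNR (comp_pre tens_lactE).
rewrite (comp_pre (eq_sym (thomL _ _ _))) tens_lactE !thomL -!compA.
rewrite (comp_pre tens_lactE) -!compA assoc_invNL (comp_pre2 (assoc_invN _ _ _)).
have E := pentagon1 A A X Y; rewrite -!compA in E; rewrite E.
by rewrite !(comp_pre (eq_sym (thomR _ _ _))) bim_lactA.
Qed.
Next Obligation.
apply: (coeq_epi (tens_qPl unit)).
rewrite -!compA thom_swap (comp_pre tens_lactE) -!compA assoc_invNL.
rewrite (comp_pre (eq_sym (thomR _ _ _))) bim_lact1 lunitN -lunit_assoc.
by rewrite -!compA assocVK compm1.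
Qed.
Next Obligation.
apply: (coeq_epi (proj2 (flat B (tens_qPr B)))).
rewrite -!compA -thomR tens_ractE !thomR -!compA (comp_pre tens_ractE) -!compA.
rewrite assocNL (comp_pre2 (eq_sym (thom_swap _ _))) (comp_pre tens_ractE) -!compA.
rewrite (comp_pre2 (assocN _ _ _)) (comp_pre2 (assocNR _ _ _)) pentagon.
by rewrite !(comp_pre (eq_sym (thomL _ _ _))) bim_ractA !thomL -!compA.
Qed.
Next Obligation.
apply: (coeq_epi (tens_qPr unit)).
rewrite -!compA -thom_swap (comp_pre tens_ractE) -!compA assocNR.
by rewrite (comp_pre (eq_sym (thomL _ _ _))) bim_ract1 runitN -runit_assoc.
Qed.
Next Obligation.
apply: (coeq_epi (proj2 (flat B (tens_qPl A)))).
rewrite -!compA -thomR tens_lactE !thomR -!compA (comp_pre tens_ractE) -!compA.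
rewrite (comp_pre2 (assocNL _ _ _)) assocN (comp_pre (eq_sym (thomL _ _ _))).
rewrite tens_ractE !thomL -!compA (comp_pre tens_lactE) -!compA.
rewrite (comp_pre2 (assoc_invNR _ _ _)) pentagon4 -!compA.
by rewrite (comp_pre2 (thom_swap _ _)).
Qed.

End Product.

Section ProductHom.
Variables (A R B : Alg C) (X X' : Bim A R) (Y Y' : Bim R B).
Variables (f : BimHom X X') (g : BimHom Y Y').

Local Notation q := (tens_q Q (bim_r X) (bim_l Y)).
Local Notation q' := (tens_q Q (bim_r X') (bim_l Y')).

Lemma tens_map_bal :
  (q' ∘ (f ⊠ g)) ∘ (bim_ract X ⊠ idm (Y : C))
  = (q' ∘ (f ⊠ g)) ∘ ((idm (X : C) ⊠ bim_lact Y) ∘ assoc X R Y).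
Proof.
rewrite -!compA -thomM compm1 bim_mapr -(comp1m g) thomM.
rewrite (comp_pre2 (bim_bal _ _)) -!compA assocN.
by rewrite !(comp_pre (eq_sym (thomM _ _ _ _))) !comp1m compm1 bim_mapl.
Qed.

Definition tens_map : Hom (tens_bim X Y : C) (tens_bim X' Y' : C) :=
  coeq_desc (tens_qP Q (bim_r X) (bim_l Y)) tens_map_bal.

Lemma tens_mapE : tens_map ∘ q = q' ∘ (f ⊠ g).
Proof. exact: coeq_descE. Qed.

Program Definition tens_hom : BimHom (tens_bim X Y) (tens_bim X' Y') :=
  {| bim_map := tens_map |}.
Next Obligation.
apply: (coeq_epi (tens_qPl X Y A)).
rewrite /= -!compA -thomL tens_mapE tens_lactE thomL (comp_pre (tens_lactE _ _)).
rewrite -!compA (comp_pre tens_mapE) -!compA assoc_invN.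
by rewrite !(comp_pre (eq_sym (thomM _ _ _ _))) comp1m compm1 bim_mapl.
Qed.
Next Obligation.
apply: (coeq_epi (tens_qPr X Y B)).
rewrite /= -!compA -thomR tens_mapE tens_ractE thomR (comp_pre (tens_ractE _ _)).
rewrite -!compA (comp_pre tens_mapE) -!compA assocN.
by rewrite !(comp_pre (eq_sym (thomM _ _ _ _))) comp1m compm1 bim_mapr.
Qed.

End ProductHom.

Section Associator.
Variables (A R T B : Alg C) (M : Bim A R) (X : Bim R T) (Y : Bim T B).

Local Notation MX := (tens_bim M X).
Local Notation XY := (tens_bim X Y).
Local Notation q U V := (tens_q Q (bim_r U) (bim_l V)).

Lemma tens_assoc_bal1 :
  (q M XY ∘ (idm (M : C) ⊠ q X Y) ∘ assoc M X Y)
    ∘ ((bim_ract M ⊠ idm (X : C)) ⊠ idm (Y : C))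
  = (q M XY ∘ (idm (M : C) ⊠ q X Y) ∘ assoc M X Y)
    ∘ (((idm (M : C) ⊠ bim_lact X) ∘ assoc M R X) ⊠ idm (Y : C)).
Proof.
rewrite -!compA assocNL (comp_pre2 (eq_sym (thom_swap _ _))).
rewrite (comp_pre2 (bim_bal M XY)) -!compA (comp_pre2 (assocNR _ _ _)).
rewrite (comp_pre (eq_sym (thomL _ _ _))) tens_lactE !thomL -!compA.
have E := pentagon5 M R X Y; rewrite -!compA in E; rewrite E.
by rewrite thomR (comp_pre2 (assocN _ _ _)).
Qed.

Definition tens_assoc1 : Hom (MX ⊗ Y) (tens_bim M XY) :=
  coeq_desc (tens_qPr M X Y) tens_assoc_bal1.

Lemma tens_assoc1E : tens_assoc1 ∘ (q M X ⊠ idm (Y : C))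
  = q M XY ∘ (idm (M : C) ⊠ q X Y) ∘ assoc M X Y.
Proof. exact: coeq_descE. Qed.

Lemma tens_assoc_bal2 :
  tens_assoc1 ∘ (bim_ract MX ⊠ idm (Y : C))
  = tens_assoc1 ∘ ((idm (MX : C) ⊠ bim_lact Y) ∘ assoc MX T Y).
Proof.
apply: (coeq_epi (proj2 (flat Y (tens_qPr M X T)))).
rewrite -!compA -thomR tens_ractE !thomR -!compA (comp_pre tens_assoc1E) -!compA.
rewrite assocNL (comp_pre2 (eq_sym (thom_swap _ _))) (comp_pre tens_assoc1E) -!compA.
rewrite (comp_pre2 (assocN _ _ _)) (comp_pre (eq_sym (thomL _ _ _))).
by rewrite bim_bal !thomL -!compA (comp_pre2 (assocNR _ _ _)) pentagon.
Qed.

(** Σ' *)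
Definition tens_assoc_map : Hom (tens_bim MX Y : C) (tens_bim M XY : C) :=
  coeq_desc (tens_qP Q (bim_r MX) (bim_l Y)) tens_assoc_bal2.

Lemma tens_assoc_q :
  tens_assoc_map ∘ q MX Y = tens_assoc1.
Proof. exact: coeq_descE. Qed.

Lemma tens_assocE :
  tens_assoc_map ∘ q MX Y ∘ (q M X ⊠ idm (Y : C))
  = q M XY ∘ (idm (M : C) ⊠ q X Y) ∘ assoc M X Y.
Proof. by rewrite tens_assoc_q tens_assoc1E. Qed.

Lemma tens_assoc_inv_bal1 :
  (q MX Y ∘ (q M X ⊠ idm (Y : C)) ∘ assoc_inv M X Y)
    ∘ (idm (M : C) ⊠ (bim_ract X ⊠ idm (Y : C)))
  = (q MX Y ∘ (q M X ⊠ idm (Y : C)) ∘ assoc_inv M X Y)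
    ∘ (idm (M : C) ⊠ ((idm (X : C) ⊠ bim_lact Y) ∘ assoc X T Y)).
Proof.
have E : q M X ∘ (idm (M : C) ⊠ bim_ract X)
    = bim_ract MX ∘ (q M X ⊠ idm (T : C)) ∘ assoc_inv M X T.
  by rewrite tens_ractE -!compA assocVK compm1.
rewrite -!compA assoc_invN (comp_pre (eq_sym (thomR _ _ _))) E !thomR -!compA.
rewrite (comp_pre2 (bim_bal MX Y)) -!compA (comp_pre2 (assocNL _ _ _)).
have F := pentagon3 M X T Y; rewrite -!compA in F; rewrite F thomL.
by rewrite (comp_pre2 (assoc_invNR _ _ _)) (comp_pre2 (thom_swap _ _)).
Qed.

Definition tens_assoc_inv1 : Hom (M ⊗ XY) (tens_bim MX Y) :=
  coeq_desc (tens_qPl X Y M) tens_assoc_inv_bal1.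

Lemma tens_assoc_inv1E : tens_assoc_inv1 ∘ (idm (M : C) ⊠ q X Y)
  = q MX Y ∘ (q M X ⊠ idm (Y : C)) ∘ assoc_inv M X Y.
Proof. exact: coeq_descE. Qed.

Lemma tens_assoc_inv_bal2 :
  tens_assoc_inv1 ∘ (bim_ract M ⊠ idm (XY : C))
  = tens_assoc_inv1 ∘ ((idm (M : C) ⊠ bim_lact XY) ∘ assoc M R XY).
Proof.
apply: (coeq_epi (tens_qPl X Y (M ⊗ R))).
rewrite -!compA thom_swap (comp_pre tens_assoc_inv1E) -!compA assoc_invNL.
rewrite (comp_pre (eq_sym (thomR _ _ _))) bim_bal !thomR -!compA.
rewrite assocNR (comp_pre (eq_sym (thomL _ _ _))) tens_lactE !thomL -!compA.
rewrite (comp_pre tens_assoc_inv1E) -!compA (comp_pre2 (assoc_invN _ _ _)).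
by have E := pentagon1 M R X Y; rewrite -!compA in E; rewrite E.
Qed.

(** Γ' *)
Definition tens_assoc_inv_map : Hom (tens_bim M XY : C) (tens_bim MX Y : C) :=
  coeq_desc (tens_qP Q (bim_r M) (bim_l XY)) tens_assoc_inv_bal2.

Lemma tens_assoc_inv_q : tens_assoc_inv_map ∘ q M XY = tens_assoc_inv1.
Proof. exact: coeq_descE. Qed.

Lemma tens_assoc_invE :
  tens_assoc_inv_map ∘ q M XY ∘ (idm (M : C) ⊠ q X Y)
  = q MX Y ∘ (q M X ⊠ idm (Y : C)) ∘ assoc_inv M X Y.
Proof. by rewrite tens_assoc_inv_q tens_assoc_inv1E. Qed.

Lemma tens3_epi (W : C) (h k : Hom (tens_bim MX Y : C) W) :
  h ∘ q MX Y ∘ (q M X ⊠ idm (Y : C)) = k ∘ q MX Y ∘ (q M X ⊠ idm (Y : C)) -> h = k.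
Proof.
move=> E; apply: (tens_epi (Q := Q) (X := bim_r MX) (Y := bim_l Y)).
exact: (coeq_epi (tens_qPr M X Y)).
Qed.

Lemma tens3_epiV (W : C) (h k : Hom (tens_bim M XY : C) W) :
  h ∘ q M XY ∘ (idm (M : C) ⊠ q X Y) = k ∘ q M XY ∘ (idm (M : C) ⊠ q X Y) -> h = k.
Proof.
move=> E; apply: (tens_epi (Q := Q) (X := bim_r M) (Y := bim_l XY)).
exact: (coeq_epi (tens_qPl X Y M)).
Qed.

Lemma tens_assoc_mapK : tens_assoc_inv_map ∘ tens_assoc_map = idm _.
Proof.
apply: tens3_epi; rewrite comp1m -2!compA (compA tens_assoc_map) tens_assocE.
by rewrite !compA tens_assoc_invE -!compA assocK compm1.
Qed.

Lemma tens_assoc_mapVK : tens_assoc_map ∘ tens_assoc_inv_map = idm _.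
Proof.
apply: tens3_epiV; rewrite comp1m -2!compA (compA tens_assoc_inv_map) tens_assoc_invE.
by rewrite !compA tens_assocE -!compA assocVK compm1.
Qed.

Program Definition tens_assoc : BimHom (tens_bim MX Y) (tens_bim M XY) :=
  {| bim_map := tens_assoc_map |}.
Next Obligation.
apply: (coeq_epi (tens_qPl MX Y A)).
apply: (coeq_epi (proj1 (flat A (tens_qPr M X Y)))).
have F := pentagon3 A M X Y; rewrite -!compA in F.
rewrite -!compA (comp_pre (tens_lactE _ _)) -!compA assoc_invN.
rewrite (comp_pre (eq_sym (thomR _ _ _))) tens_lactE !thomR -!compA.
rewrite !compA tens_assocE -!compA (comp_pre2 (assocNL _ _ _)) F.
rewrite -!thomL (compA tens_assoc_map) tens_assocE !thomL -!compA /= (comp_pre (tens_lactE _ _)) -!compA.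
by rewrite (comp_pre2 (assoc_invNR _ _ _)) (comp_pre2 (thom_swap _ _)).
Qed.
Next Obligation.
apply: (coeq_epi (tens_qPr MX Y B)).
apply: (coeq_epi (proj2 (flat B (tens_qPr M X Y)))).
rewrite -!compA (comp_pre (tens_ractE _ _)) -!compA assocNL.
rewrite (comp_pre2 (eq_sym (thom_swap _ _))) !compA tens_assocE -!compA.
rewrite -!thomR (compA tens_assoc_map) tens_assocE !thomR -!compA.
rewrite /= (comp_pre (tens_ractE _ _)) -!compA (comp_pre2 (assocN _ _ _)).
rewrite (comp_pre (eq_sym (thomL _ _ _))) tens_ractE !thomL -!compA.
by rewrite (comp_pre2 (assocNR _ _ _)) pentagon.
Qed.

Definition tens_assoc_inv : BimHom (tens_bim M XY) (tens_bim MX Y) :=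
  bimhom_inv (f := tens_assoc) tens_assoc_mapK tens_assoc_mapVK.

End Associator.

Section Unitors.
Variables (A B : Alg C) (X : Bim A B).

Local Notation ql := (tens_q Q (bim_r (reg_bim A)) (bim_l X)).
Local Notation qr := (tens_q Q (bim_r X) (bim_l (reg_bim B))).

Lemma tens_lunit_bal :
  bim_lact X ∘ (mul A ⊠ idm (X : C))
  = bim_lact X ∘ ((idm (A : C) ⊠ bim_lact X) ∘ assoc A A X).
Proof. by rewrite bim_lactA -compA. Qed.

(** Υ' *)
Definition tens_lunit_map : Hom (tens_bim (reg_bim A) X : C) (X : C) :=
  coeq_desc (tens_qP Q (bim_r (reg_bim A)) (bim_l X)) tens_lunit_bal.

Lemma tens_lunitE : tens_lunit_map ∘ ql = bim_lact X.
Proof. exact: coeq_descE. Qed.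

Definition tens_lunit_inv_map : Hom (X : C) (tens_bim (reg_bim A) X : C) :=
  ql ∘ (one A ⊠ idm (X : C)) ∘ lunit_inv X.

Lemma tens_lunit_mapVK : tens_lunit_map ∘ tens_lunit_inv_map = idm (X : C).
Proof.
by rewrite /tens_lunit_inv_map !compA tens_lunitE bim_lact1 lunitVK.
Qed.

Lemma tens_lunit_mapK : tens_lunit_inv_map ∘ tens_lunit_map = idm _.
Proof.
apply: (tens_epi (Q := Q) (X := bim_r (reg_bim A)) (Y := bim_l X)).
rewrite comp1m -compA tens_lunitE /tens_lunit_inv_map.
have E : lunit_inv X ∘ bim_lact X = (idm unit ⊠ bim_lact X) ∘ lunit_inv (A ⊗ X).
  apply: (split_mono (lunitK _)); rewrite compA lunitVK comp1m compA lunitN.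
  by rewrite -compA lunitVK compm1.
rewrite -!compA E (comp_pre2 (thom_swap _ _)).
have F := bim_bal (reg_bim A) X; rewrite /= in F.
have G : ql ∘ (idm (A : C) ⊠ bim_lact X) = ql ∘ (mul A ⊠ idm (X : C)) ∘ assoc_inv _ _ _.
  by rewrite F -!compA assocVK compm1.
rewrite (comp_pre G) -!compA (comp_pre2 (assoc_invNL _ _ _)).
rewrite (comp_pre (eq_sym (thomR _ _ _))) mul1a -lunit_assoc.
by rewrite -!compA (comp_pre (assocVK _ _ _)) comp1m lunitVK compm1.
Qed.

Program Definition tens_lunit : BimHom (tens_bim (reg_bim A) X) X :=
  {| bim_map := tens_lunit_map |}.
Next Obligation.
apply: (coeq_epi (tens_qPl (reg_bim A) X A)).
rewrite -!compA -thomL tens_lunitE (tens_lactE (reg_bim A) X) !compA tens_lunitE /=.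
by rewrite bim_lactA -!compA assocVK compm1.
Qed.
Next Obligation.
apply: (coeq_epi (tens_qPr (reg_bim A) X B)).
rewrite -!compA -thomR tens_lunitE (tens_ractE (reg_bim A) X) !compA tens_lunitE.
by rewrite bim_lract.
Qed.

Definition tens_lunit_inv : BimHom X (tens_bim (reg_bim A) X) :=
  bimhom_inv (f := tens_lunit) tens_lunit_mapK tens_lunit_mapVK.

Lemma tens_runit_bal :
  bim_ract X ∘ (bim_ract X ⊠ idm (B : C))
  = bim_ract X ∘ ((idm (X : C) ⊠ mul B) ∘ assoc X B B).
Proof. by rewrite bim_ractA -compA. Qed.

(** Υ *)
Definition tens_runit_map : Hom (tens_bim X (reg_bim B) : C) (X : C) :=
  coeq_desc (tens_qP Q (bim_r X) (bim_l (reg_bim B))) tens_runit_bal.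

Lemma tens_runitE : tens_runit_map ∘ qr = bim_ract X.
Proof. exact: coeq_descE. Qed.

Definition tens_runit_inv_map : Hom (X : C) (tens_bim X (reg_bim B) : C) :=
  qr ∘ (idm (X : C) ⊠ one B) ∘ runit_inv X.

Lemma tens_runit_mapVK : tens_runit_map ∘ tens_runit_inv_map = idm (X : C).
Proof.
by rewrite /tens_runit_inv_map !compA tens_runitE bim_ract1 runitVK.
Qed.

Lemma tens_runit_mapK : tens_runit_inv_map ∘ tens_runit_map = idm _.
Proof.
apply: (tens_epi (Q := Q) (X := bim_r X) (Y := bim_l (reg_bim B))).
rewrite comp1m -compA tens_runitE /tens_runit_inv_map.
have E : runit_inv X ∘ bim_ract X = (bim_ract X ⊠ idm unit) ∘ runit_inv (X ⊗ B).
  apply: (split_mono (runitK _)); rewrite compA runitVK comp1m compA runitN.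
  by rewrite -compA runitVK compm1.
rewrite -!compA E (comp_pre2 (eq_sym (thom_swap _ _))).
rewrite (comp_pre2 (bim_bal X (reg_bim B))) -!compA (comp_pre2 (assocNR _ _ _)).
rewrite (comp_pre (eq_sym (thomL _ _ _))) mula1 (comp_pre (runit_assoc _ _)).
by rewrite runitVK compm1.
Qed.

Program Definition tens_runit : BimHom (tens_bim X (reg_bim B)) X :=
  {| bim_map := tens_runit_map |}.
Next Obligation.
apply: (coeq_epi (tens_qPl X (reg_bim B) A)).
rewrite -!compA -thomL tens_runitE (tens_lactE X (reg_bim B)) !compA tens_runitE.
by rewrite bim_lract -!compA assocVK compm1.
Qed.
Next Obligation.
apply: (coeq_epi (tens_qPr X (reg_bim B) B)).
rewrite -!compA -thomR tens_runitE (tens_ractE X (reg_bim B)) !compA tens_runitE.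
by rewrite bim_ractA.
Qed.

Definition tens_runit_inv : BimHom X (tens_bim X (reg_bim B)) :=
  bimhom_inv (f := tens_runit) tens_runit_mapK tens_runit_mapVK.

End Unitors.

Section Laws.

Local Notation q U V := (tens_q Q (bim_r U) (bim_l V)).

Lemma tens_map1 (A R B : Alg C) (X : Bim A R) (Y : Bim R B) :
  tens_map (bimhom_id X) (bimhom_id Y) = idm (tens_bim X Y : C).
Proof. by apply: tens_epi; rewrite tens_mapE /= thom1 compm1 comp1m. Qed.

Lemma tens_mapM (A R B : Alg C) (X X' X'' : Bim A R) (Y Y' Y'' : Bim R B)
    (f' : BimHom X' X'') (f : BimHom X X') (g' : BimHom Y' Y'') (g : BimHom Y Y') :
  tens_map (bimhom_comp f' f) (bimhom_comp g' g) = tens_map f' g' ∘ tens_map f g.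
Proof.
apply: tens_epi; rewrite tens_mapE /= thomM -compA tens_mapE.
by rewrite !compA tens_mapE.
Qed.

Lemma tens_assocN (A R T B : Alg C) (M M' : Bim A R) (X X' : Bim R T)
    (Y Y' : Bim T B) (f : BimHom M M') (g : BimHom X X') (h : BimHom Y Y') :
  tens_assoc_map M' X' Y' ∘ tens_map (tens_hom f g) h
  = tens_map f (tens_hom g h) ∘ tens_assoc_map M X Y.
Proof.
have L : (tens_map f g ⊠ h) ∘ (q M X ⊠ idm (Y : C))
    = (q M' X' ⊠ idm (Y' : C)) ∘ ((f ⊠ g) ⊠ h).
  by rewrite -!thomM tens_mapE compm1 comp1m.
have K : (f ⊠ tens_map g h) ∘ (idm (M : C) ⊠ q X Y)
    = (idm (M' : C) ⊠ q X' Y') ∘ (f ⊠ (g ⊠ h)).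
  by rewrite -!thomM tens_mapE compm1 comp1m.
have E := tens_assocE M X Y; rewrite -!compA in E.
apply: tens3_epi; rewrite -!compA E (comp_pre (tens_mapE _ _)) /= -!compA L.
by rewrite !compA tens_assocE -!compA assocN (comp_pre (tens_mapE _ _)) -!compA
  (comp_pre2 K).
Qed.

Lemma tens_lunitN (A B : Alg C) (X X' : Bim A B) (f : BimHom X X') :
  tens_lunit_map X' ∘ tens_map (bimhom_id (reg_bim A)) f = f ∘ tens_lunit_map X.
Proof.
apply: tens_epi; rewrite -!compA tens_mapE tens_lunitE.
by rewrite compA tens_lunitE bim_mapl.
Qed.

Lemma tens_runitN (A B : Alg C) (X X' : Bim A B) (f : BimHom X X') :
  tens_runit_map X' ∘ tens_map f (bimhom_id (reg_bim B)) = f ∘ tens_runit_map X.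
Proof.
apply: tens_epi; rewrite -!compA tens_mapE tens_runitE.
by rewrite compA tens_runitE bim_mapr.
Qed.

Lemma tens_triangle (A R B : Alg C) (X : Bim A R) (Y : Bim R B) :
  tens_map (bimhom_id X) (tens_lunit Y) ∘ tens_assoc_map X (reg_bim R) Y
  = tens_map (tens_runit X) (bimhom_id Y).
Proof.
have E := tens_assocE X (reg_bim R) Y; rewrite -!compA in E.
apply: tens3_epi; rewrite -!compA E !(comp_pre (tens_mapE _ _)) /= -!compA.
rewrite -thomR tens_runitE (comp_pre (eq_sym (thomL _ _ _))) tens_lunitE.
by rewrite (bim_bal X Y).
Qed.

Lemma tens_pentagon (A R S T B : Alg C) (W : Bim A R) (X : Bim R S) (Y : Bim S T)
    (Z : Bim T B) :
  tens_assoc_map W X (tens_bim Y Z) ∘ tens_assoc_map (tens_bim W X) Y Z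
  = tens_map (bimhom_id W) (tens_assoc X Y Z) ∘ (tens_assoc_map W (tens_bim X Y) Z
      ∘ tens_map (tens_assoc W X Y) (bimhom_id Z)).
Proof.
have E1 := tens_assocE (tens_bim W X) Y Z; rewrite -!compA in E1.
have E2 := tens_assocE W X (tens_bim Y Z); rewrite -!compA in E2.
have E3 := tens_assocE W X Y; rewrite -!compA in E3.
have E4 := tens_assocE W (tens_bim X Y) Z; rewrite -!compA in E4.
have E5 := tens_assocE X Y Z; rewrite -!compA in E5.
apply: tens3_epi; apply: (coeq_epi (proj2 (flat Z (tens_qPr W X Y)))).
rewrite -?compA (comp_pre3 E1) -?compA assocNL (comp_pre2 (eq_sym (thom_swap _ _))).
rewrite (comp_pre3 E2) -?compA (comp_pre2 (assocNR _ _ _)) pentagon.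
rewrite (comp_pre (tens_mapE _ _)) /= -?compA -!thomR E3 !thomR -?compA.
rewrite (comp_pre3 E4) -?compA (comp_pre (tens_mapE _ _)) /= -?compA.
rewrite (comp_pre2 (assocN _ _ _)) !(comp_pre (eq_sym (thomL _ _ _))) -?compA E5.
by rewrite !thomL -?compA.
Qed.

End Laws.

Section BimMonoidal.
Variable R : Alg C.

Program Definition bim_monoidal : MonoidalCategory := {|
  mcat := bim_cat R R;
  tobj := fun X Y : Bim R R => tens_bim X Y;
  thom := fun (X X' Y Y' : Bim R R) f g => tens_hom f g;
  unit := reg_bim R;
  assoc := fun X Y Z : Bim R R => tens_assoc X Y Z;
  assoc_inv := fun X Y Z : Bim R R => tens_assoc_inv X Y Z;
  lunit := fun X : Bim R R => tens_lunit X;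
  lunit_inv := fun X : Bim R R => tens_lunit_inv X;
  runit := fun X : Bim R R => tens_runit X;
  runit_inv := fun X : Bim R R => tens_runit_inv X
|}.
Next Obligation. by move=> *; apply: bimhom_ext; apply: tens_map1. Qed.
Next Obligation. by move=> *; apply: bimhom_ext; apply: tens_mapM. Qed.
Next Obligation. by move=> *; apply: bimhom_ext; apply: tens_assoc_mapK. Qed.
Next Obligation. by move=> *; apply: bimhom_ext; apply: tens_assoc_mapVK. Qed.
Next Obligation. by move=> *; apply: bimhom_ext; apply: tens_lunit_mapK. Qed.
Next Obligation. by move=> *; apply: bimhom_ext; apply: tens_lunit_mapVK. Qed.
Next Obligation. by move=> *; apply: bimhom_ext; apply: tens_runit_mapK. Qed.
Next Obligation. by move=> *; apply: bimhom_ext; apply: tens_runit_mapVK. Qed.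
Next Obligation. by move=> *; apply: bimhom_ext; apply: tens_assocN. Qed.
Next Obligation. by move=> *; apply: bimhom_ext; apply: tens_lunitN. Qed.
Next Obligation. by move=> *; apply: bimhom_ext; apply: tens_runitN. Qed.
Next Obligation. by move=> *; apply: bimhom_ext; apply: tens_pentagon. Qed.
Next Obligation. by move=> *; apply: bimhom_ext; apply: tens_triangle. Qed.

End BimMonoidal.

Program Definition tens_functor (A R B : Alg C) (Y : Bim R B) :
    Functor (bim_cat A R) (bim_cat A B) := {|
  fobj := fun X : bim_cat A R => tens_bim X Y : bim_cat A B;
  fmap := fun (X X' : Bim A R) f => tens_hom f (bimhom_id Y)
|}.
Next Obligation. by move=> *; apply: bimhom_ext; apply: tens_map1. Qed.
Next Obligation.
move=> A R B Y X X' X'' g f; apply: bimhom_ext; rewrite /= -tens_mapM.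
by congr tens_map; apply: bimhom_ext; rewrite /= comp1m.
Qed.

Section Extension.
Variables (R S : Alg C) (i : AlgHom R S).

(** [S] as an [(R, R)]-, [(R, S)]- and [(S, R)]-bimodule. *)
Definition ext_RR : Bim R R := restrl i (restrr i (reg_bim S)).
Definition ext_RS : Bim R S := restrl i (reg_bim S).
Definition ext_SR : Bim S R := restrr i (reg_bim S).

Lemma ext_mul_bal :
  mul S ∘ (bim_ract ext_RR ⊠ idm (S : C))
  = mul S ∘ ((idm (S : C) ⊠ bim_lact ext_RR) ∘ assoc S R S).
Proof.
rewrite /= thomR thomL compA mulA -!compA; congr (_ ∘ _).
by rewrite assocN.
Qed.

(** m^R_S *)
Definition ext_mul_map : Hom (tens_bim ext_RR ext_RR : C) S :=
  coeq_desc (tens_qP Q (bim_r ext_RR) (bim_l ext_RR)) ext_mul_bal.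

Lemma ext_mulE : ext_mul_map ∘ tens_q Q (bim_r ext_RR) (bim_l ext_RR) = mul S.
Proof. exact: coeq_descE. Qed.

Program Definition ext_mul : BimHom (tens_bim ext_RR ext_RR) ext_RR :=
  {| bim_map := ext_mul_map |}.
Next Obligation.
apply: (coeq_epi (tens_qPl _ _ _)).
rewrite -(compA (bim_lact ext_RR)) -thomL ext_mulE.
rewrite -compA (tens_lactE ext_RR ext_RR) !compA ext_mulE /=.
rewrite thomR !compA mulA -!compA; congr (_ ∘ _).
by rewrite (comp_pre2 (assocNL _ _ _)) assocVK compm1 thom_swap.
Qed.
Next Obligation.
apply: (coeq_epi (tens_qPr _ _ _)).
rewrite -(compA (bim_ract ext_RR)) -thomR ext_mulE.
rewrite -compA (tens_ractE ext_RR ext_RR) !compA ext_mulE /=.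
rewrite thomL -!compA -assocNR -thom_swap !compA; congr (_ ∘ _).
by rewrite mulA.
Qed.

Program Definition ext_one : BimHom (reg_bim R) ext_RR :=
  {| bim_map := alg_map i |}.
Next Obligation. by rewrite /= alg_mapM -compA -thomRL. Qed.
Next Obligation. by rewrite /= alg_mapM -compA -thomLR. Qed.

Program Definition ext_alg : Alg (bim_monoidal R) :=
  {| alg_obj := ext_RR : bim_monoidal R; mul := ext_mul; one := ext_one |}.
Next Obligation.
apply: bimhom_ext; apply: (tens3_epi (M := ext_RR) (X := ext_RR) (Y := ext_RR)).
have E := tens_assocE ext_RR ext_RR ext_RR; rewrite -!compA in E.
rewrite /= -!compA E !(comp_pre (tens_mapE _ _)) /= -!compA.
rewrite !(comp_pre ext_mulE) -thomR (comp_pre (eq_sym (thomL _ _ _))) ext_mulE.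
by rewrite mulA compA.
Qed.
Next Obligation.
apply: bimhom_ext; apply: (tens_epi (Q := Q) (X := bim_r (reg_bim R)) (Y := bim_l ext_RR)).
by rewrite /= -!compA (tens_mapE ext_one (bimhom_id ext_RR)) (comp_pre ext_mulE) (tens_lunitE ext_RR).
Qed.
Next Obligation.
apply: bimhom_ext; apply: (tens_epi (Q := Q) (X := bim_r ext_RR) (Y := bim_l (reg_bim R))).
by rewrite /= -!compA (tens_mapE (bimhom_id ext_RR) ext_one) (comp_pre ext_mulE) (tens_runitE ext_RR).
Qed.

Definition ext_SS : Bim S S := tens_bim ext_SR ext_RS.

(** [ext_SS] and [tens_bim ext_RR ext_RR] have the same underlying object, by
    conversion: their coequalizers are taken of the same pair. *)
Definition frobenius_extension : Prop :=
  exists (theta : BimHom ext_RR (reg_bim R)) (e : Hom unit (ext_SS : C)),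
    bim_lact ext_SS ∘ (idm (S : C) ⊠ e) ∘ runit_inv S
      = bim_ract ext_SS ∘ (e ⊠ idm (S : C)) ∘ lunit_inv S /\
    tens_map (bimhom_id ext_RR) theta ∘ e = tens_runit_inv ext_RR ∘ one S /\
    tens_map theta (bimhom_id ext_RR) ∘ e = tens_lunit_inv ext_RR ∘ one S.

End Extension.

End TensorBim.

(* Main.v *)
(** Everything goes through (vii). An adjunction [Y ⊣ X] makes [Hom (Z ⊗ X) W] and
    [Hom Z (W ⊗ Y)] correspond, and identities between morphisms into [W ⊗ Y] are
    checked on the other side. For an associative form [lam : A ⊗ A -> unit] with
    [A ⊣ A], every right [A]-module [X] then has a canonical linear coaction
    [X -> X ⊗ A], the mate of its action; for [X = A] it is the bilinear
    comultiplication, for general [X] the unit of the adjunction in (ix). The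
    statements on right duals are those on left duals in the reversed monoidal
    category. Under the generator hypothesis, the unit and counit of an adjunction as
    in (ix) are determined by their components at the unit object, which yield the
    comultiplication and the counit. *)

From Corelib Require Import ssreflect.
Require Import Defs.

Set Implicit Arguments.
Unset Strict Implicit.
Unset Printing Implicit Defensive.

Local Open Scope cat_scope.

(** * Coherence and mates *)

Section Coherence.
Variable D : MonoidalCategory.

Lemma assocNM (X Y Y' Z : D) (g : Hom Y Y') :
  assoc X Y' Z ∘ ((idm X ⊠ g) ⊠ idm Z) = (idm X ⊠ (g ⊠ idm Z)) ∘ assoc X Y Z.
Proof. exact: assocN. Qed.

Lemma runit_inv_nat (X Y : D) (f : Hom X Y) :
  runit_inv Y ∘ f = (f ⊠ idm unit) ∘ runit_inv X.
Proof.
apply: (split_mono (runitK Y)).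
by rewrite !compA runitVK comp1m runitN -compA runitVK compm1.
Qed.

Lemma lunit_inv_nat (X Y : D) (f : Hom X Y) :
  lunit_inv Y ∘ f = (idm unit ⊠ f) ∘ lunit_inv X.
Proof.
apply: (split_mono (lunitK Y)).
by rewrite !compA lunitVK comp1m lunitN -compA lunitVK compm1.
Qed.

Lemma triangle_runit (X Y : D) :
  (runit X ⊠ idm Y) ∘ assoc_inv X unit Y = idm X ⊠ lunit Y.
Proof. by rewrite -triangle -compA assocVK compm1. Qed.

Lemma triangle_runit_inv (X Y : D) :
  assoc X unit Y ∘ (runit_inv X ⊠ idm Y) = idm X ⊠ lunit_inv Y.
Proof.
apply: (split_mono (f := idm X ⊠ lunit Y) (g := idm X ⊠ lunit_inv Y)).
  by rewrite -thomL lunitK thom1.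
by rewrite compA triangle -thomL -thomR lunitVK runitVK !thom1.
Qed.

Lemma runit_assoc_inv (X Y : D) :
  runit (X ⊗ Y) ∘ assoc_inv X Y unit = idm X ⊠ runit Y.
Proof. by rewrite -runit_assoc -compA assocVK compm1. Qed.

Lemma assoc_runit_inv (X Y : D) :
  assoc X Y unit ∘ runit_inv (X ⊗ Y) = idm X ⊠ runit_inv Y.
Proof.
apply: (split_mono (f := idm X ⊠ runit Y) (g := idm X ⊠ runit_inv Y)).
  by rewrite -thomL runitK thom1.
by rewrite compA runit_assoc -thomL !runitVK thom1.
Qed.

Lemma assoc_lunit_inv (X Y : D) :
  assoc unit X Y ∘ (lunit_inv X ⊠ idm Y) = lunit_inv (X ⊗ Y).
Proof.
apply: (split_mono (lunitK (X ⊗ Y))).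
by rewrite compA lunit_assoc -thomR !lunitVK thom1.
Qed.

(** Kelly's argument: naturality of [lunit] at [lunit unit] makes the triangle axiom compare both
    unitors tensored with [unit], and tensoring with [unit] is faithful. *)
Lemma runit_unit : runit (@unit D) = lunit unit.
Proof.
have E : lunit (unit ⊗ unit) = idm unit ⊠ lunit (@unit D).
  by apply: (split_mono (lunitK (@unit D))); rewrite lunitN.
have F : runit (@unit D) ⊠ idm unit = lunit unit ⊠ idm unit.
  by rewrite -triangle -E lunit_assoc.
by apply: (split_epi (runitVK (unit ⊗ unit))); rewrite -!runitN F.
Qed.

End Coherence.

(** * Mates under an adjunction *)

Section Adjunction.
Variables (D : MonoidalCategory) (Y X : D).
Variables (rho : Hom unit (X ⊗ Y)) (lam : Hom (Y ⊗ X) unit).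

Definition curry (Z W : D) (f : Hom (Z ⊗ X) W) : Hom Z (W ⊗ Y) :=
  (f ⊠ idm Y) ∘ assoc_inv Z X Y ∘ (idm Z ⊠ rho) ∘ runit_inv Z.

Definition uncurry (Z W : D) (h : Hom Z (W ⊗ Y)) : Hom (Z ⊗ X) W :=
  runit W ∘ (idm W ⊠ lam) ∘ assoc W Y X ∘ (h ⊠ idm X).

Lemma curry_post (Z W W' : D) (k : Hom W W') (f : Hom (Z ⊗ X) W) :
  curry (k ∘ f) = (k ⊠ idm Y) ∘ curry f.
Proof. by rewrite /curry thomR -!compA. Qed.

Lemma curry_pre (Z Z' W : D) (f : Hom (Z ⊗ X) W) (g : Hom Z' Z) :
  curry (f ∘ (g ⊠ idm X)) = curry f ∘ g.
Proof.
rewrite /curry thomR -!compA runit_inv_nat.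
by rewrite (comp_pre2 (eq_sym (thom_swap _ _))) (comp_pre2 (assoc_invNL _ _ _)).
Qed.

Lemma uncurry_pre (Z Z' W : D) (h : Hom Z (W ⊗ Y)) (g : Hom Z' Z) :
  uncurry (h ∘ g) = uncurry h ∘ (g ⊠ idm X).
Proof. by rewrite /uncurry thomR -!compA. Qed.

Lemma uncurry_post (Z W W' : D) (k : Hom W W') (h : Hom Z (W ⊗ Y)) :
  uncurry ((k ⊠ idm Y) ∘ h) = k ∘ uncurry h.
Proof.
rewrite /uncurry thomR -!compA (comp_pre2 (assocNL _ _ _)).
by rewrite (comp_pre2 (eq_sym (thom_swap _ _))) (comp_pre2 (runitN _)).
Qed.

(** Taking mates commutes with tensoring on the left; this is what computes the coaction of a free
    module. *)
Lemma uncurry_tensl (U Z W : D) (h : Hom Z (W ⊗ Y)) :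
  uncurry (assoc_inv U W Y ∘ (idm U ⊠ h)) = (idm U ⊠ uncurry h) ∘ assoc U Z X.
Proof.
rewrite /uncurry thomR -!compA (comp_pre (pentagon4 _ _ _ _)) -!compA assocNM.
rewrite (comp_pre2 (eq_sym (assoc_invNR _ _ _))) (comp_pre (runit_assoc_inv _ _)).
by rewrite !thomL -!compA.
Qed.

Hypothesis adj : is_adjunction rho lam.

(** By naturality in [W] it suffices to treat [f = idm (Z ⊗ X)], where the claim is [Z] tensored
    with the first triangle identity. *)
Lemma curryK (Z W : D) (f : Hom (Z ⊗ X) W) : uncurry (curry f) = f.
Proof.
have /(f_equal (thom (idm Z))) := proj1 adj.
rewrite !thomL thom1 -!compA => E.
have {}E : uncurry (curry (idm (Z ⊗ X))) = idm (Z ⊗ X).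
  rewrite /uncurry /curry thom1 comp1m !thomR -!compA.
  rewrite (comp_pre (pentagon4 _ _ _ _)) -!compA (comp_pre2 (assocNM _ _ _)).
  rewrite triangle_runit_inv (comp_pre2 (eq_sym (assoc_invNR _ _ _))).
  by rewrite (comp_pre (runit_assoc_inv _ _)).
by rewrite -{1}(compm1 f) curry_post uncurry_post E compm1.
Qed.

(** By naturality in [Z] it suffices to treat the identity of [W ⊗ Y], where the claim is [W]
    tensored with the second triangle identity. *)
Lemma uncurryK (Z W : D) (h : Hom Z (W ⊗ Y)) : curry (uncurry h) = h.
Proof.
have /(f_equal (thom (idm W))) := proj2 adj.
rewrite !thomL thom1 -!compA => E.
rewrite -[h in LHS]comp1m uncurry_pre curry_pre -[RHS]comp1m; congr (_ ∘ _).
rewrite /uncurry /curry thom1 compm1 !thomR -!compA.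
have P := pentagon1 W Y X Y; rewrite -!compA in P.
rewrite (comp_pre2 (eq_sym P)) -!compA (comp_pre2 (assocNR _ _ _)) assoc_runit_inv.
rewrite (comp_pre2 (eq_sym (assoc_invN _ _ _))).
by rewrite (comp_pre (triangle_runit _ _)).
Qed.

Lemma uncurry_inj (Z W : D) (h k : Hom Z (W ⊗ Y)) : uncurry h = uncurry k -> h = k.
Proof. by move=> E; rewrite -(uncurryK h) E uncurryK. Qed.

Lemma uncurry_lunit (Z : D) (h : Hom Z (unit ⊗ Y)) :
  uncurry h = lam ∘ ((lunit Y ∘ h) ⊠ idm X).
Proof.
rewrite /uncurry runit_unit lunitN thomR -lunit_assoc -!compA.
by [].
Qed.

End Adjunction.

(** * Associative forms and Frobenius algebras *)

Section FrobeniusForm.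
Variables (D : MonoidalCategory) (A : Alg D).
Variables (rho : Hom unit (A ⊗ A)) (lam : Hom (A ⊗ A) unit).
Hypotheses (adj : is_adjunction rho lam) (lamA : associative lam).

Definition form_counit : Hom (A : D) unit :=
  lam ∘ (idm (A : D) ⊠ one A) ∘ runit_inv A.

(** [x ↦ x · rho] *)
Definition coact (X : RMod A) : Hom (X : D) (X ⊗ A) := curry rho (ract X).

(** Associativity gives [lam (x y, 1) = lam (x, y 1)], so an associative form is determined by the
    functional [lam (-, 1)]. *)
Lemma form_counit_mul : form_counit ∘ mul A = lam.
Proof.
rewrite /form_counit -!compA runit_inv_nat (comp_pre2 (eq_sym (thom_swap _ _))).
rewrite (comp_pre lamA) -!compA (comp_pre2 (assocNR _ _ _)) assoc_runit_inv.
by rewrite -!thomL (comp_pre (mula1 A)) runitVK thom1 compm1.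
Qed.

Lemma uncurry_coact (X : RMod A) : uncurry lam (coact X) = ract X.
Proof. exact: curryK. Qed.

(** Associativity of [lam] moves a multiplication on the last factor of [Y ⊗ A] over to the argument
    of the mate. *)
Lemma uncurry_linear (X Y : D) (h : Hom X (Y ⊗ A)) :
  uncurry lam ((idm Y ⊠ mul A) ∘ assoc Y A A ∘ (h ⊠ idm (A : D)))
  = uncurry lam h ∘ (idm X ⊠ mul A) ∘ assoc X A A.
Proof.
rewrite /uncurry !thomR -!compA (comp_pre2 (assocNM _ _ _)).
rewrite (comp_pre (eq_sym (thomL _ _ _))) lamA !thomL -!compA.
rewrite (comp_pre3 (eq_sym (pentagon Y A A A))) -!compA assocNL.
by rewrite (comp_pre2 (thom_swap _ _)) (comp_pre2 (assocNR _ _ _)).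
Qed.

(** The mates of the two sides are [(x a) b] and [x (a b)]. *)
Lemma coact_linear (X : RMod A) :
  coact X ∘ ract X
  = (idm (X : D) ⊠ mul A) ∘ assoc X A A ∘ (coact X ⊠ idm (A : D)).
Proof.
apply: (uncurry_inj adj).
by rewrite uncurry_linear uncurry_pre uncurry_coact ractA.
Qed.

Lemma coact_natural (X X' : RMod A) (f : Hom (X : D) X') :
  f ∘ ract X = ract X' ∘ (f ⊠ idm (A : D)) ->
  (f ⊠ idm (A : D)) ∘ coact X = coact X' ∘ f.
Proof. by rewrite /coact -curry_post -curry_pre => ->. Qed.

(** Since [form_counit] is [lam (-, 1)], the left side is the mate of the coaction evaluated at [1],
    that is, [x 1]. *)
Lemma coact_counit (X : RMod A) :
  runit X ∘ (idm (X : D) ⊠ form_counit) ∘ coact X = idm (X : D).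
Proof.
have E : uncurry lam (coact X) ∘ (idm (X : D) ⊠ one A) ∘ runit_inv X = idm (X : D).
  by rewrite uncurry_coact ract1 runitVK.
rewrite -[RHS]E /uncurry /form_counit !thomL -!compA.
rewrite (comp_pre2 (thom_swap _ _)) (comp_pre2 (assocNR _ _ _)).
by rewrite -runit_inv_nat (comp_pre (assoc_runit_inv _ _)).
Qed.

Program Definition reg_rmod : RMod A := {| rmod_obj := A : D; ract := mul A |}.
Next Obligation. exact: mulA. Qed.
Next Obligation. exact: mula1. Qed.

Program Definition free_rmod (Y : D) : RMod A :=
  {| rmod_obj := Y ⊗ A; ract := (idm Y ⊠ mul A) ∘ assoc Y A A |}.
Next Obligation. exact: (ractA (tensor_rmod Y reg_rmod)). Qed.
Next Obligation. exact: (ract1 (tensor_rmod Y reg_rmod)). Qed.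

Definition comul : Hom (A : D) (A ⊗ A) := coact reg_rmod.

Lemma coact_free (Y : D) :
  coact (free_rmod Y) = assoc_inv Y A A ∘ (idm Y ⊠ comul).
Proof.
by apply: (uncurry_inj adj); rewrite uncurry_coact uncurry_tensl (uncurry_coact reg_rmod).
Qed.

(** Applying the counit to the mate of [mul A] gives the mate of [lam]; the claim is then the second
    triangle identity. *)
Lemma counit_comul : lunit A ∘ (form_counit ⊠ idm (A : D)) ∘ comul = idm (A : D).
Proof.
by rewrite -compA /comul /coact -curry_post form_counit_mul -[RHS](proj2 adj) /curry -!compA.
Qed.

Lemma comul_counit : runit A ∘ (idm (A : D) ⊠ form_counit) ∘ comul = idm (A : D).
Proof. exact: (coact_counit reg_rmod). Qed.

(** Left linearity is naturality of the coaction along [mul A], a linear map from the free module on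
    [A] to the regular one. *)
Lemma comul_bilinear : bilinear_comul comul.
Proof.
split; last exact: (coact_linear reg_rmod).
rewrite -compA -coact_free.
rewrite (@coact_natural (free_rmod A) reg_rmod (mul A)) //=.
by rewrite compA mulA.
Qed.

(** Naturality of the coaction along [comul] itself, which is linear into the free module on [A]. *)
Lemma comul_coassoc :
  assoc A A A ∘ (comul ⊠ idm (A : D)) ∘ comul = (idm (A : D) ⊠ comul) ∘ comul.
Proof.
have E := @coact_natural reg_rmod (free_rmod A) comul (proj2 comul_bilinear).
rewrite -compA.
have /= -> := E.
by rewrite coact_free !compA assocVK comp1m.
Qed.

Lemma coact_free_counit (Y : D) :
  ((runit Y ∘ (idm Y ⊠ form_counit)) ⊠ idm (A : D)) ∘ coact (free_rmod Y)
  = idm (Y ⊗ A).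
Proof.
rewrite coact_free thomR -!compA (comp_pre2 (eq_sym (assoc_invN _ _ _))).
rewrite (comp_pre (triangle_runit _ _)) -!thomL.
by rewrite compA counit_comul thom1.
Qed.

End FrobeniusForm.

(** * Associative forms, bilinear comultiplications and dual modules *)

Section FrobeniusAlgebra.
Variables (D : MonoidalCategory) (A : Alg D).

(** Bilinearity gives [a delta(1) = delta(a) = delta(1) a], which turns each triangle identity into
    a counit law. *)
Lemma bilinear_adjunction (delta : Hom (A : D) (A ⊗ A)) (eps : Hom (A : D) unit) :
  bilinear_comul delta ->
  lunit A ∘ (eps ⊠ idm (A : D)) ∘ delta = idm (A : D) ->
  runit A ∘ (idm (A : D) ⊠ eps) ∘ delta = idm (A : D) ->
  is_adjunction (delta ∘ one A) (eps ∘ mul A).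
Proof.
move=> [L R] El Er; split; rewrite ?thomL ?thomR -!compA.
  rewrite -!compA in R Er.
  by rewrite (comp_pre3 (eq_sym R)) -!compA (comp_pre (mul1a A)) lunitVK compm1.
rewrite -!compA in L El.
by rewrite (comp_pre3 (eq_sym L)) -!compA (comp_pre (mula1 A)) runitVK compm1.
Qed.

Lemma associative_comp_mul (X : D) (theta : Hom (A : D) X) :
  associative (theta ∘ mul A).
Proof. by rewrite /associative -!compA mulA -!compA. Qed.

(** Exhibits the action on the dual as the mate of [(phi, a, b) ↦ phi (a b)], whence the
    characterization by evaluation that follows. *)
Lemma ldual_ractE (d : LeftDual A) :
  ldual_ract d
  = lunit d ∘ curry (coev d) (ev d ∘ (idm (d : D) ⊠ mul A) ∘ assoc d A A).
Proof. by rewrite /ldual_ract /curry !thomR -!compA. Qed.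

Lemma ev_ldual_ract (d : LeftDual A) :
  ev d ∘ (ldual_ract d ⊠ idm (A : D))
  = ev d ∘ (idm (d : D) ⊠ mul A) ∘ assoc d A A.
Proof. by rewrite ldual_ractE -uncurry_lunit (curryK (ldualP d)). Qed.

Lemma ev_Phi_l (d : LeftDual A) (B : Hom (A ⊗ A) unit) :
  ev d ∘ (Phi_l d B ⊠ idm (A : D)) = B.
Proof.
have -> : Phi_l d B = lunit d ∘ curry (coev d) B by rewrite /Phi_l /curry -!compA.
by rewrite -uncurry_lunit (curryK (ldualP d)).
Qed.

Lemma ev_inj (d : LeftDual A) (Z : D) (f g : Hom Z d) :
  ev d ∘ (f ⊠ idm (A : D)) = ev d ∘ (g ⊠ idm (A : D)) -> f = g.
Proof.
move=> E; apply: (split_mono (lunitVK d)); apply: (uncurry_inj (ldualP d)).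
by rewrite !uncurry_lunit !compA lunitVK !comp1m.
Qed.

(** A map into the dual is determined by its pairing with [A]; the pairings of the two sides of
    linearity are the two sides of associativity. *)
Lemma linear_associative (d : LeftDual A) (f : Hom (A : D) d) :
  f ∘ mul A = ldual_ract d ∘ (f ⊠ idm (A : D)) <->
  associative (ev d ∘ (f ⊠ idm (A : D))).
Proof.
have E : ev d ∘ ((ldual_ract d ∘ (f ⊠ idm (A : D))) ⊠ idm (A : D))
    = ev d ∘ (f ⊠ idm (A : D)) ∘ (idm (A : D) ⊠ mul A) ∘ assoc A A A.
  rewrite thomR compA ev_ldual_ract -!compA assocNL.
  by rewrite (comp_pre2 (eq_sym (thom_swap _ _))).
rewrite /associative -E -compA -thomR.
by split=> [-> | /ev_inj].
Qed.

Lemma transport_adjunction (d : LeftDual A) (f : Hom (A : D) d)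
    (g : Hom (d : D) A) (fK : g ∘ f = idm (A : D)) (gK : f ∘ g = idm (d : D)) :
  is_adjunction ((idm (A : D) ⊠ g) ∘ coev d) (ev d ∘ (f ⊠ idm (A : D))).
Proof.
have [E1 E2] := ldualP d; split.
  rewrite -[RHS]E1 !thomL thomR -!compA (comp_pre2 (assocNM _ _ _)).
  by rewrite !(comp_pre (eq_sym (thomL _ _ _))) -compA -thomR gK thom1 compm1.
(* The identity is written as [g ∘ f] with the second triangle identity of [d] inserted in the
   middle. *)
rewrite -[RHS]fK -[f in RHS]comp1m -{}E2 !thomL !thomR -!compA.
rewrite (comp_pre2 (assoc_invNR _ _ _)) (comp_pre2 (eq_sym (lunitN _))).
rewrite runit_inv_nat !(comp_pre2 (eq_sym (thom_swap _ _))).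
by rewrite (comp_pre2 (assoc_invNL _ _ _)) (comp_pre2 (eq_sym (thom_swap _ _))).
Qed.

Definition frobenius_form : Prop :=
  exists (rho : Hom unit (A ⊗ A)) (lam : Hom (A ⊗ A) unit),
    is_adjunction rho lam /\ associative lam.

Lemma frobenius_form_coalgebra : frobenius_form ->
  exists (delta : Hom (A : D) (A ⊗ A)) (eps : Hom (A : D) unit),
    is_coalgebra delta eps /\ bilinear_comul delta.
Proof.
move=> [rho [lam [adj lamA]]]; exists (comul rho), (form_counit lam); split.
  split; first exact: (comul_coassoc adj lamA).
  by split; [exact: (counit_comul adj lamA) | exact: (comul_counit adj)].
exact: (comul_bilinear adj lamA).
Qed.

Lemma frobenius_form_Phi_l : frobenius_form ->
  exists (d : LeftDual A) (B : Hom (A ⊗ A) unit), associative B /\ is_iso (Phi_l d B).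
Proof.
move=> [rho [lam [adj lamA]]].
(* With [A] as its own dual, [Phi_l] is the left side of the second triangle identity, hence the
   identity. *)
exists {| ldual := A : D; coev := rho; ev := lam; ldualP := adj |}, lam; split=> //.
rewrite /Phi_l /= (proj2 adj).
by exists (idm (A : D)); rewrite comp1m.
Qed.

Lemma Phi_l_iso_modules (d : LeftDual A) (B : Hom (A ⊗ A) unit) :
  associative B -> is_iso (Phi_l d B) -> right_modules_isomorphic (mul A) (ldual_ract d).
Proof.
move=> BA isoB; exists (Phi_l d B); split=> //.
by apply/linear_associative; rewrite ev_Phi_l.
Qed.

Lemma iso_modules_frobenius_form (d : LeftDual A) :
  right_modules_isomorphic (mul A) (ldual_ract d) -> frobenius_form.
Proof.
move=> [f [[g [fK gK]] flin]].
exists ((idm (A : D) ⊠ g) ∘ coev d), (ev d ∘ (f ⊠ idm (A : D))); split.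
  exact: transport_adjunction.
exact/linear_associative.
Qed.

End FrobeniusAlgebra.

(** * Reversal of the tensor product, exchanging left and right duals *)

Section Reverse.
Variable D : MonoidalCategory.

Program Definition rev_monoidal : MonoidalCategory := {|
  mcat := D;
  tobj := fun X Y : D => Y ⊗ X;
  thom := fun (X X' Y Y' : D) f g => g ⊠ f;
  unit := unit;
  assoc := fun X Y Z : D => assoc_inv Z Y X;
  assoc_inv := fun X Y Z : D => assoc Z Y X;
  lunit := fun X : D => runit X;
  lunit_inv := fun X : D => runit_inv X;
  runit := fun X : D => lunit X;
  runit_inv := fun X : D => lunit_inv X
|}.
Next Obligation. exact: thom1. Qed.
Next Obligation. exact: thomM. Qed.
Next Obligation. exact: assocVK. Qed.
Next Obligation. exact: assocK. Qed.
Next Obligation. exact: runitK. Qed.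
Next Obligation. exact: runitVK. Qed.
Next Obligation. exact: lunitK. Qed.
Next Obligation. exact: lunitVK. Qed.
Next Obligation. exact: assoc_invN. Qed.
Next Obligation. exact: runitN. Qed.
Next Obligation. exact: lunitN. Qed.
Next Obligation. by rewrite compA pentagon2. Qed.
Next Obligation. exact: triangle_runit. Qed.

Program Definition rev_alg (A : Alg D) : Alg rev_monoidal :=
  {| alg_obj := (A : D) : rev_monoidal; mul := mul A; one := one A |}.
Next Obligation. by rewrite /= mulA -compA assocVK compm1. Qed.
Next Obligation. exact: mula1. Qed.
Next Obligation. exact: mul1a. Qed.

Variable A : Alg D.

Lemma rev_associative (X : D) (B : Hom (A ⊗ A) X) :
  @associative rev_monoidal (rev_alg A) X B <-> associative B.
Proof.
rewrite /associative /=; split=> E.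
  by rewrite E -compA assocK compm1.
by rewrite E -compA assocVK compm1.
Qed.

(** Reversal only makes the two triangle identities trade places. *)
Lemma rev_adjunction (Y X : D) (rho : Hom unit (X ⊗ Y)) (lam : Hom (Y ⊗ X) unit) :
  @is_adjunction rev_monoidal X Y rho lam <-> is_adjunction rho lam.
Proof. by split=> -[]. Qed.

Lemma rev_frobenius_form : frobenius_form (rev_alg A) <-> frobenius_form A.
Proof.
split=> -[rho [lam [adj lamA]]]; exists rho, lam.
  by split; [exact/rev_adjunction | exact/rev_associative].
by split; [exact/rev_adjunction | exact/rev_associative].
Qed.

Definition rev_ldual (d : RightDual A) : LeftDual (rev_alg A) :=
  @Build_LeftDual rev_monoidal (rev_alg A) (d : D) (coev' d) (ev' d)
    (proj2 (rev_adjunction _ _) (rdualP d)).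

Definition rev_rdual (d : LeftDual (rev_alg A)) : RightDual A :=
  @Build_RightDual D A (d : D) (coev d) (ev d) (proj1 (rev_adjunction _ _) (ldualP d)).

Lemma frobenius_form_Phi_r : frobenius_form A ->
  exists (d : RightDual A) (B : Hom (A ⊗ A) unit), associative B /\ is_iso (Phi_r d B).
Proof.
move=> /rev_frobenius_form /frobenius_form_Phi_l [d [B [BA iso]]].
by exists (rev_rdual d), B; split; first exact/rev_associative.
Qed.

Lemma Phi_r_iso_modules (d : RightDual A) (B : Hom (A ⊗ A) unit) :
  associative B -> is_iso (Phi_r d B) -> left_modules_isomorphic (mul A) (rdual_lact d).
Proof.
move=> BA iso.
exact: (@Phi_l_iso_modules _ _ (rev_ldual d) B (proj2 (rev_associative _) BA) iso).
Qed.

Lemma iso_modules_frobenius_form_r (d : RightDual A) :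
  left_modules_isomorphic (mul A) (rdual_lact d) -> frobenius_form A.
Proof.
move=> iso; apply/rev_frobenius_form.
exact: (iso_modules_frobenius_form (d := rev_ldual d)).
Qed.

End Reverse.

(** * Frobenius extensions *)

Section Extension.
Variables (C : MonoidalCategory) (Q : Coequalizers C).
Hypothesis flat : forall M : C, coflat M.
Variables (R S : Alg C) (i : AlgHom R S).

Local Notation SRR := (ext_RR i).
Local Notation SS := (ext_SS Q flat i).
Local Notation D := (bim_monoidal Q flat R).
Local Notation A := (ext_alg Q flat i).
Local Notation q U V := (tens_q Q (bim_r U) (bim_l V)).
Local Notation qSS := (q SRR SRR).

Lemma ext_SS_lactE :
  bim_lact SS ∘ (idm (S : C) ⊠ qSS) = qSS ∘ (mul S ⊠ idm (S : C)) ∘ assoc_inv S S S.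
Proof. exact: (tens_lactE Q flat (ext_SR i) (ext_RS i)). Qed.

Lemma ext_SS_ractE :
  bim_ract SS ∘ (qSS ⊠ idm (S : C)) = qSS ∘ (idm (S : C) ⊠ mul S) ∘ assoc S S S.
Proof. exact: (tens_ractE Q flat (ext_SR i) (ext_RS i)). Qed.

(** Identifies multiplication on the outer left factor, formed in the bimodule category, with the
    action of [S] on [ext_SS] in [C]; the next lemma does the same on the right. *)
Lemma tens_mul_lact :
  tens_map Q flat (ext_mul Q flat i) (bimhom_id SRR) ∘ tens_assoc_inv_map Q flat SRR SRR SRR
    ∘ q SRR (tens_bim Q flat SRR SRR) = bim_lact SS.
Proof.
apply: (coeq_epi (tens_qPl Q flat SRR SRR S)).
rewrite ext_SS_lactE -!compA.
have E := tens_assoc_invE Q flat SRR SRR SRR; rewrite -!compA in E; rewrite E.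
rewrite (comp_pre (tens_mapE Q flat _ _)) /= -!compA (comp_pre (eq_sym (thomR _ _ _))).
by rewrite ext_mulE.
Qed.

Lemma tens_mul_ract :
  tens_map Q flat (bimhom_id SRR) (ext_mul Q flat i) ∘ tens_assoc_map Q flat SRR SRR SRR
    ∘ q (tens_bim Q flat SRR SRR) SRR = bim_ract SS.
Proof.
apply: (coeq_epi (tens_qPr Q flat SRR SRR S)).
rewrite ext_SS_ractE -!compA.
have E := tens_assocE Q flat SRR SRR SRR; rewrite -!compA in E; rewrite E.
rewrite (comp_pre (tens_mapE Q flat _ _)) /= -!compA (comp_pre (eq_sym (thomL _ _ _))).
by rewrite ext_mulE.
Qed.

(** Bilinearity in the bimodule category is tested after the epimorphism [qSS], where it becomes
    bilinearity over [S] in [C]. *)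
Lemma ext_bilinear_comulP (delta : BimHom SRR (tens_bim Q flat SRR SRR)) :
  @bilinear_comul D A delta <->
  delta ∘ mul S = bim_lact SS ∘ (idm (S : C) ⊠ delta) /\
  delta ∘ mul S = bim_ract SS ∘ (delta ⊠ idm (S : C)).
Proof.
have L : (tens_map Q flat (ext_mul Q flat i) (bimhom_id SRR)
      ∘ tens_assoc_inv_map Q flat SRR SRR SRR
      ∘ tens_map Q flat (bimhom_id SRR) delta) ∘ qSS
    = bim_lact SS ∘ (idm (S : C) ⊠ delta).
  by rewrite -!compA tens_mapE -tens_mul_lact -!compA.
have N : (tens_map Q flat (bimhom_id SRR) (ext_mul Q flat i)
      ∘ tens_assoc_map Q flat SRR SRR SRR ∘ tens_map Q flat delta (bimhom_id SRR)) ∘ qSS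
    = bim_ract SS ∘ (delta ⊠ idm (S : C)).
  by rewrite -!compA tens_mapE -tens_mul_ract -!compA.
have M : (delta ∘ ext_mul_map Q flat i) ∘ qSS = delta ∘ mul S by rewrite -compA ext_mulE.
rewrite -L -N -M; split=> -[El Er].
  move: El Er => /(f_equal (@bim_map _ _ _ _ _)) /= El.
  by move=> /(f_equal (@bim_map _ _ _ _ _)) /= Er; rewrite -El -Er.
by split; apply: bimhom_ext; apply: tens_epi.
Qed.

(** With its right-hand counterpart, this lets linearity over [S] imply linearity over [R]. *)
Lemma tens_ext_lact :
  bim_lact (tens_bim Q flat SRR SRR) = bim_lact SS ∘ (i ⊠ idm (SS : C)).
Proof.
apply: (coeq_epi (tens_qPl Q flat SRR SRR R)).
rewrite -compA thom_swap compA ext_SS_lactE -!compA assoc_invNL.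
rewrite (comp_pre (eq_sym (thomR _ _ _))).
by have /= -> := tens_lactE Q flat SRR SRR; rewrite -compA.
Qed.

Lemma tens_ext_ract :
  bim_ract (tens_bim Q flat SRR SRR) = bim_ract SS ∘ (idm (SS : C) ⊠ i).
Proof.
apply: (coeq_epi (tens_qPr Q flat SRR SRR R)).
rewrite -compA -thom_swap compA ext_SS_ractE -!compA assocNR.
rewrite (comp_pre (eq_sym (thomL _ _ _))).
by have /= -> := tens_ractE Q flat SRR SRR; rewrite -compA.
Qed.

(** * The comultiplication of a Casimir element *)

Section CasimirElement.
Variable e : Hom unit (SS : C).

Definition casimir_comul : Hom (S : C) (SS : C) :=
  bim_lact SS ∘ (idm (S : C) ⊠ e) ∘ runit_inv S.

Lemma casimir_comul_linearl :
  casimir_comul ∘ mul S = bim_lact SS ∘ (idm (S : C) ⊠ casimir_comul).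
Proof.
rewrite /casimir_comul !thomL -!compA runit_inv_nat.
rewrite (comp_pre2 (eq_sym (thom_swap _ _))) compA bim_lactA -!compA.
by rewrite (comp_pre2 (assocNR _ _ _)) assoc_runit_inv.
Qed.

Hypothesis eC : casimir_comul = bim_ract SS ∘ (e ⊠ idm (S : C)) ∘ lunit_inv S.

Lemma casimir_comul_linearr :
  casimir_comul ∘ mul S = bim_ract SS ∘ (casimir_comul ⊠ idm (S : C)).
Proof.
rewrite eC !thomR -!compA lunit_inv_nat.
rewrite (comp_pre2 (thom_swap _ _)) (compA (bim_ract SS) (bim_ract SS ⊠ _)).
rewrite bim_ractA -!compA (comp_pre2 (assocNL _ _ _)).
by rewrite assoc_lunit_inv.
Qed.

Lemma casimir_comul_linear :
  casimir_comul ∘ bim_lact SRR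
    = bim_lact (tens_bim Q flat SRR SRR) ∘ (idm (R : C) ⊠ casimir_comul) /\
  casimir_comul ∘ bim_ract SRR
    = bim_ract (tens_bim Q flat SRR SRR) ∘ (casimir_comul ⊠ idm (R : C)).
Proof.
rewrite tens_ext_lact tens_ext_ract; split.
  rewrite [bim_lact SRR]/= compA casimir_comul_linearl -!compA; congr (_ ∘ _).
  by rewrite thom_swap.
rewrite [bim_ract SRR]/= compA casimir_comul_linearr -!compA; congr (_ ∘ _).
by rewrite thom_swap.
Qed.

(** The map [h : s ⊗ t ↦ s i(theta t)] is left [S]-linear, so [h (s e) = s h(e)], and the hypothesis
    gives [h(e) = 1]. *)
Lemma casimir_comul_counit (theta : BimHom SRR (reg_bim R)) :
  tens_map Q flat (bimhom_id SRR) theta ∘ e = tens_runit_inv Q flat SRR ∘ one S ->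
  tens_runit_map Q flat SRR ∘ tens_map Q flat (bimhom_id SRR) theta ∘ casimir_comul
  = idm (S : C).
Proof.
move=> E; set h := (X in X ∘ casimir_comul).
have hq : h ∘ qSS = mul S ∘ (idm (S : C) ⊠ (i ∘ theta)).
  by rewrite -compA tens_mapE compA tens_runitE /= thomL compA.
have hl : h ∘ bim_lact SS = mul S ∘ (idm (S : C) ⊠ h).
  apply: (coeq_epi (tens_qPl Q flat SRR SRR S)).
  move: (i ∘ theta) hq => f hq.
  rewrite -!compA ext_SS_lactE -thomL hq !compA hq thomL compA.
  rewrite -(compA _ _ (mul S ⊠ _)) -thom_swap compA mulA -!compA.
  by rewrite (comp_pre2 (assocNR _ _ _)) assocVK compm1.
rewrite /casimir_comul !compA hl -!compA (comp_pre (eq_sym (thomL _ _ _))).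
have -> : h ∘ e = one S.
  by rewrite /h -compA E compA tens_runit_mapVK comp1m.
by rewrite compA mula1 runitVK.
Qed.

(** Here [h : s ⊗ t ↦ i(theta s) t] is right [S]-linear, and the comultiplication is read as
    [s ↦ e s]. *)
Lemma casimir_counit_comul (theta : BimHom SRR (reg_bim R)) :
  tens_map Q flat theta (bimhom_id SRR) ∘ e = tens_lunit_inv Q flat SRR ∘ one S ->
  tens_lunit_map Q flat SRR ∘ tens_map Q flat theta (bimhom_id SRR) ∘ casimir_comul
  = idm (S : C).
Proof.
move=> E; set h := (X in X ∘ casimir_comul).
have hq : h ∘ qSS = mul S ∘ ((i ∘ theta) ⊠ idm (S : C)).
  by rewrite -compA tens_mapE compA tens_lunitE /= thomR compA.
have hr : h ∘ bim_ract SS = mul S ∘ (h ⊠ idm (S : C)).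
  apply: (coeq_epi (tens_qPr Q flat SRR SRR S)).
  move: (i ∘ theta) hq => f hq.
  rewrite -!compA ext_SS_ractE -thomR hq !compA hq thomR compA mulA.
  by rewrite -!compA assocNL (comp_pre2 (thom_swap _ _)).
rewrite eC !compA hr -!compA (comp_pre (eq_sym (thomR _ _ _))).
have -> : h ∘ e = one S.
  by rewrite /h -compA E compA tens_lunit_mapVK comp1m.
by rewrite compA mul1a lunitVK.
Qed.

End CasimirElement.

(** The Frobenius system is [eps] and [delta(1)]: bilinearity makes [delta(1)] a Casimir element,
    and the counit laws at [1] give the two normalizations. *)
Lemma coalgebra_frobenius_extension
    (delta : BimHom SRR (tens_bim Q flat SRR SRR)) (eps : BimHom SRR (reg_bim R)) :
  @is_coalgebra D (A : D) delta eps -> @bilinear_comul D A delta ->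
  frobenius_extension Q flat i.
Proof.
move=> [_ [El Er]] /ext_bilinear_comulP [Bl Br].
exists eps, (delta ∘ one S); split.
  rewrite thomL thomR !compA -Bl -Br -!compA.
  by rewrite !(comp_pre (mula1 S)) !(comp_pre (mul1a S)) lunitVK runitVK.
move: El Er => /(f_equal (@bim_map _ _ _ _ _)) /= El /(f_equal (@bim_map _ _ _ _ _)) /= Er.
split; rewrite compA; congr (_ ∘ _).
  by rewrite -[RHS]compm1 -Er !compA tens_runit_mapK comp1m.
by rewrite -[RHS]compm1 -El !compA tens_lunit_mapK comp1m.
Qed.

Lemma frobenius_extension_form : frobenius_extension Q flat i -> frobenius_form A.
Proof.
move=> [theta [e [eC [Er El]]]].
have [Ll Lr] := casimir_comul_linear eC.
pose delta : Hom (A : D) ((A : D) ⊗ A) :=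
  @Build_BimHom C R R SRR (tens_bim Q flat SRR SRR) (casimir_comul e) Ll Lr.
pose eps : Hom (A : D) unit := theta.
exists (delta ∘ one A), (eps ∘ mul A); split; last exact: associative_comp_mul.
apply: bilinear_adjunction.
- apply/ext_bilinear_comulP; split; first exact: casimir_comul_linearl.
  exact: casimir_comul_linearr.
- by apply: bimhom_ext; apply: casimir_counit_comul.
- by apply: bimhom_ext; apply: casimir_comul_counit.
Qed.

End Extension.

(** * The forgetful functor and its adjoints *)

Section NaturalFamilies.
Variables (D : MonoidalCategory) (A : Alg D).
Hypothesis gen : left_tensor_generator (@unit D).

Local Notation free_act Y := ((idm Y ⊠ mul A) ∘ assoc Y A A).

(** [e] models the counit of an adjunction as in (ix), and [k] its unit at free modules, both
    transported to [Y ⊗ A]; [e_k] and [k_e] are the triangle identities. *)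
Variables (e : forall Y : D, Hom (Y ⊗ A) Y)
  (k : forall Y : D, Hom (Y ⊗ A) ((Y ⊗ A) ⊗ A)).
Hypotheses
  (eN : forall (Y Y' : D) (g : Hom Y Y'), g ∘ e Y = e Y' ∘ (g ⊠ idm (A : D)))
  (kN : forall (Y Y' : D) (g : Hom (Y ⊗ A) (Y' ⊗ A)),
    g ∘ free_act Y = free_act Y' ∘ (g ⊠ idm (A : D)) ->
    (g ⊠ idm (A : D)) ∘ k Y = k Y' ∘ g)
  (k_linear : forall Y : D,
    k Y ∘ free_act Y = free_act (Y ⊗ A) ∘ (k Y ⊠ idm (A : D)))
  (e_k : forall Y : D, e (Y ⊗ A) ∘ k Y = idm (Y ⊗ A))
  (k_e : forall Y : D, (e Y ⊠ idm (A : D)) ∘ k Y = idm (Y ⊗ A)).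

Let theta : Hom (A : D) unit := e unit ∘ lunit_inv A.
Let delta : Hom (A : D) (A ⊗ A) :=
  (lunit A ⊠ idm (A : D)) ∘ k unit ∘ lunit_inv A.

(** Both sides are natural in [Y] and agree for [Y = unit], so they agree after
    composition with every [unit -> Y]. *)
Lemma eval_unit (Y : D) : e Y = runit Y ∘ (idm Y ⊠ theta).
Proof.
apply: gen => p.
rewrite -eN -compA -thom_swap (comp_pre2 (runitN _)); congr (_ ∘ _).
by rewrite runit_unit lunitN /theta -compA lunitK compm1.
Qed.

Lemma comul_unit (Y : D) : k Y = assoc_inv Y A A ∘ (idm Y ⊠ delta).
Proof.
apply: gen => p.
(* The map [p ⊠ idm A] is linear between free modules, so [k] is natural along it. *)
have E : (p ⊠ idm (A : D)) ∘ free_act unit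
    = free_act Y ∘ ((p ⊠ idm (A : D)) ⊠ idm (A : D)).
  by rewrite compA thom_swap -!compA assocNL.
rewrite -(kN E) -compA -thom_swap (comp_pre2 (assoc_invNL _ _ _)); congr (_ ∘ _).
rewrite /delta.
apply: assoc_mono.
rewrite (comp_pre (assocVK _ _ _)) comp1m.
apply: (split_mono (lunitK _)).
rewrite lunitN compA lunit_assoc -!compA lunitK compm1.
by [].
Qed.

(** Left linearity of [delta] is naturality of [k] along the linear map [A ⊗ A -> unit ⊗ A] given by
    [mul A]; right linearity and the counit laws are [k_linear], [k_e] and [e_k] at [unit]. *)
Lemma natural_frobenius_form : frobenius_form A.
Proof.
have lin_mul : lunit_inv A ∘ mul A ∘ free_act (A : D)
    = free_act unit ∘ ((lunit_inv A ∘ mul A) ⊠ idm (A : D)).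
  rewrite thomR -!compA (comp_pre (assoc_lunit_inv _ _)).
  by rewrite (comp_pre2 (eq_sym (lunit_inv_nat _))) mulA -!compA.
exists (delta ∘ one A), (theta ∘ mul A); split; last exact: associative_comp_mul.
apply: bilinear_adjunction.
- split.
    rewrite -compA -comul_unit /delta -!compA -(kN lin_mul) thomR -!compA.
    by rewrite (comp_pre (eq_sym (thomR _ _ _))) lunitVK thom1 comp1m.
  rewrite /delta -!compA lunit_inv_nat -assoc_lunit_inv.
  have K := k_linear unit; rewrite -!compA in K.
  rewrite (comp_pre3 K) -!compA -thomR.
  by rewrite (comp_pre2 (thom_swap _ _)) (comp_pre2 (eq_sym (assocNL _ _ _))) -thomR.
- rewrite /delta /theta -!compA (comp_pre (eq_sym (thomR _ _ _))) -compA lunitK compm1.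
  by rewrite (comp_pre (k_e unit)) comp1m lunitVK.
- rewrite -eval_unit /delta -!compA (comp_pre2 (eq_sym (eN _))).
  by rewrite (comp_pre (e_k unit)) comp1m lunitVK.
Qed.

End NaturalFamilies.

(** [F : M -> D] behaves as the forgetful functor from right [A]-modules, and [G] as
    the free module functor, up to the isomorphism [free_iso]. *)
Record module_model (D : MonoidalCategory) (A : Alg D) (M : Category)
    (F : Functor M D) (G : Functor D M) : Type := {
  act : forall X : M, Hom (F X ⊗ A) (F X);
  actA : forall X : M,
    act X ∘ (act X ⊠ idm (A : D)) = act X ∘ (idm (F X) ⊠ mul A) ∘ assoc _ _ _;
  act1 : forall X : M, act X ∘ (idm (F X) ⊠ one A) = runit (F X);
  fmap_act : forall (X X' : M) (f : Hom X X'),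
    fmap F f ∘ act X = act X' ∘ (fmap F f ⊠ idm (A : D));
  fmap_inj : forall (X X' : M) (f g : Hom X X'), fmap F f = fmap F g -> f = g;
  lift : forall (X X' : M) (h : Hom (F X) (F X')),
    h ∘ act X = act X' ∘ (h ⊠ idm (A : D)) -> Hom X X';
  liftE : forall (X X' : M) (h : Hom (F X) (F X'))
    (E : h ∘ act X = act X' ∘ (h ⊠ idm (A : D))), fmap F (lift E) = h;
  free_iso : forall Y : D, Hom (F (G Y)) (Y ⊗ A);
  free_iso_inv : forall Y : D, Hom (Y ⊗ A) (F (G Y));
  free_isoK : forall Y : D, free_iso_inv Y ∘ free_iso Y = idm (F (G Y));
  free_isoVK : forall Y : D, free_iso Y ∘ free_iso_inv Y = idm (Y ⊗ A);
  free_isoN : forall (Y Y' : D) (f : Hom Y Y'),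
    free_iso Y' ∘ fmap F (fmap G f) = (f ⊠ idm (A : D)) ∘ free_iso Y;
  free_iso_act : forall Y : D, free_iso Y ∘ act (G Y)
    = (idm Y ⊠ mul A) ∘ assoc Y A A ∘ (free_iso Y ⊠ idm (A : D))
}.

(** * The free module functor as left and as right adjoint *)

Section ModuleModel.
Variables (D : MonoidalCategory) (A : Alg D) (M : Category).
Variables (F : Functor M D) (G : Functor D M) (mm : module_model A F G).

Local Notation a := (act mm).
Local Notation j := (free_iso mm).
Local Notation jV := (free_iso_inv mm).

Definition model_rmod (X : M) : RMod A :=
  {| rmod_obj := F X; ract := a X; ractA := actA mm X; ract1 := act1 mm X |}.

Lemma free_iso_invN (Y Y' : D) (f : Hom Y Y') :
  fmap F (fmap G f) ∘ jV Y = jV Y' ∘ (f ⊠ idm (A : D)).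
Proof.
apply: (split_mono (free_isoK mm Y')).
rewrite compA free_isoN compA free_isoVK comp1m.
by rewrite -compA free_isoVK compm1.
Qed.

Lemma free_iso_inv_act (Y : D) : a (G Y) ∘ (jV Y ⊠ idm (A : D))
  = jV Y ∘ (idm Y ⊠ mul A) ∘ assoc Y A A.
Proof.
apply: (split_mono (free_isoK mm Y)).
rewrite compA free_iso_act -!compA -thomR free_isoVK thom1 compm1.
by rewrite (comp_pre (free_isoVK mm Y)) comp1m.
Qed.

(** The usual free-forgetful adjunction: the unit is [y ↦ y ⊗ 1], the counit is the action. *)
Lemma free_adjoint : adjoint_functors G F.
Proof.
have L (X : M) : a X ∘ j (F X) ∘ a (G (F X))
    = a X ∘ ((a X ∘ j (F X)) ⊠ idm (A : D)).
  by rewrite -compA free_iso_act thomR (compA (a X) (a X ⊠ _)) actA -!compA.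
exists (fun Y : D => jV Y ∘ (idm Y ⊠ one A) ∘ runit_inv Y), (fun X : M => lift (L X)).
split; [|split; [|split]].
- move=> Y Y' f.
  rewrite !compA free_iso_invN -!compA runit_inv_nat.
  by rewrite (comp_pre2 (thom_swap _ _)).
- move=> X X' f; apply: (fmap_inj mm).
  by rewrite !fmapM !liftE compA fmap_act -!compA free_isoN.
- move=> Y; apply: (fmap_inj mm).
  rewrite fmapM liftE fmap1.
  apply: (split_mono (free_isoK mm Y)).
  rewrite compm1 -!compA free_isoN !thomR.
  rewrite (comp_pre (free_iso_act mm Y)) -!compA.
  rewrite !(comp_pre (eq_sym (thomR _ _ _))).
  rewrite !compA free_isoVK comp1m.
  rewrite thomR -!compA (comp_pre2 (assocNM _ _ _)) (comp_pre (eq_sym (thomL _ _ _))).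
  by rewrite mul1a (comp_pre (triangle _ _)) (comp_pre (eq_sym (thomR _ _ _)))
    runitVK thom1 comp1m.
- move=> X; rewrite liftE -!compA (comp_pre (free_isoVK mm _)) comp1m.
  by rewrite compA act1 runitVK.
Qed.

Section FromForm.
Variables (rho : Hom unit (A ⊗ A)) (lam : Hom (A ⊗ A) unit).
Hypotheses (adj : is_adjunction rho lam) (lamA : associative lam).

(** The unit is the coaction and the counit is [form_counit] on the factor [A]; the triangle
    identities are [coact_counit] and [coact_free_counit]. *)
Lemma form_adjoint : adjoint_functors F G.
Proof.
have L (X : M) : jV (F X) ∘ coact rho (model_rmod X) ∘ a X
    = a (G (F X)) ∘ ((jV (F X) ∘ coact rho (model_rmod X)) ⊠ idm (A : D)).
  move: (coact_linear adj lamA (model_rmod X)); move: (coact _ _) => /= c E.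
  by rewrite thomR compA free_iso_inv_act -!compA E -!compA.
exists (fun X : M => lift (L X)),
  (fun Y : D => runit Y ∘ (idm Y ⊠ form_counit lam) ∘ j Y).
split; [|split; [|split]].
- move=> X X' f; apply: (fmap_inj mm).
  rewrite !fmapM !liftE compA free_iso_invN.
  have E := @coact_natural _ _ rho (model_rmod X) (model_rmod X') _ (fmap_act mm f).
  by rewrite -compA E compA.
- move=> Y Y' f.
  rewrite -!compA free_isoN (comp_pre2 (eq_sym (thom_swap _ _))).
  by rewrite (comp_pre2 (runitN _)).
- move=> X; rewrite liftE -compA (comp_pre (free_isoVK mm _)) comp1m.
  exact: (coact_counit adj (model_rmod X)).
- move=> Y; apply: (fmap_inj mm).
  rewrite fmapM liftE fmap1 compA free_iso_invN thomR -!compA.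
  have E : j Y ∘ a (G Y) = ract (free_rmod A Y) ∘ (j Y ⊠ idm (A : D)).
    by rewrite free_iso_act.
  rewrite (@coact_natural _ _ rho (model_rmod (G Y)) (free_rmod A Y) _ E).
  by rewrite (comp_pre (coact_free_counit adj lamA Y)) comp1m free_isoK.
Qed.

End FromForm.

(** Needed because naturality of a unit is available only along morphisms of [M]. *)
Lemma free_linear_lift (Y Y' : D) (g : Hom (Y ⊗ A) (Y' ⊗ A)) :
  g ∘ ((idm Y ⊠ mul A) ∘ assoc Y A A)
    = (idm Y' ⊠ mul A) ∘ assoc Y' A A ∘ (g ⊠ idm (A : D)) ->
  exists f : Hom (G Y) (G Y'), fmap F f = jV Y' ∘ g ∘ j Y.
Proof.
move=> E.
have L : jV Y' ∘ g ∘ j Y ∘ a (G Y)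
    = a (G Y') ∘ ((jV Y' ∘ g ∘ j Y) ⊠ idm (A : D)).
  rewrite -!compA free_iso_act (compA g) E !thomR (compA (a _)) free_iso_inv_act.
  by rewrite -!compA.
by exists (lift L); rewrite liftE.
Qed.

Lemma adjoint_frobenius_form :
  left_tensor_generator (@unit D) -> adjoint_functors F G -> frobenius_form A.
Proof.
move=> gen [eta [eps [etaN [epsN [eps_eta eta_eps]]]]].
(* [h] is the unit [eta] read as a coaction; it is linear because it comes from a morphism of [M],
   and its last two properties are the triangle identities. *)
have [h [hN [hlin [eps_h h_eps]]]] : exists h : forall X : M, Hom (F X) (F X ⊗ A),
    (forall (X X' : M) (f : Hom X X'),
      (fmap F f ⊠ idm (A : D)) ∘ h X = h X' ∘ fmap F f) /\
    (forall X : M, h X ∘ a X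
      = (idm (F X) ⊠ mul A) ∘ assoc (F X) A A ∘ (h X ⊠ idm (A : D))) /\
    (forall X : M, eps (F X) ∘ jV (F X) ∘ h X = idm (F X)) /\
    (forall Y : D, (eps Y ⊠ idm (A : D)) ∘ h (G Y) = j Y).
{ exists (fun X : M => j (F X) ∘ fmap F (eta X)).
  split; [|split; [|split]].
  - by move=> X X' f; rewrite compA -free_isoN -!compA -!fmapM etaN.
  - by move=> X; rewrite -compA fmap_act compA free_iso_act thomR -!compA.
  - by move=> X; rewrite -!compA (comp_pre (free_isoK mm _)) comp1m.
  - by move=> Y; rewrite compA -free_isoN -compA -fmapM eta_eps fmap1 compm1. }
have eN (Y Y' : D) (g : Hom Y Y') :
    g ∘ (eps Y ∘ jV Y) = eps Y' ∘ jV Y' ∘ (g ⊠ idm (A : D)).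
  by rewrite compA epsN -!compA free_iso_invN.
apply: (@natural_frobenius_form D A gen (fun Y => eps Y ∘ jV Y)
  (fun Y => (j Y ⊠ idm (A : D)) ∘ h (G Y) ∘ jV Y)) => // [Y Y' g|Y|Y|Y].
- move=> /free_linear_lift [f Ef].
  have E : g ∘ j Y = j Y' ∘ fmap F f.
    by rewrite Ef -!compA (comp_pre (free_isoVK mm Y')) comp1m.
  rewrite -!compA (comp_pre (eq_sym (thomR _ _ _))) E thomR -!compA.
  rewrite (comp_pre2 (hN _ _ f)); congr (_ ∘ (_ ∘ _)).
  by rewrite Ef -!compA free_isoVK compm1.
- rewrite -compA (compA (jV Y)) -free_iso_inv_act -!compA.
  rewrite (comp_pre2 (hlin _)) !thomR -!compA (comp_pre2 (thom_swap _ _)).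
  by rewrite (comp_pre2 (eq_sym (assocNL _ _ _))).
- rewrite -!compA (compA (eps _)) (comp_pre2 (eq_sym (eN _ _ (j Y)))).
  by rewrite (compA _ (h _)) eps_h comp1m free_isoVK.
- rewrite -!compA (comp_pre (eq_sym (thomR _ _ _))) -compA free_isoK compm1.
  by rewrite (comp_pre (h_eps Y)) free_isoVK.
Qed.

End ModuleModel.

(** * Bimodules over [R] and [S] as modules over the algebra [S] in the category of [R]-bimodules *)

Section ExtensionModules.
Variables (C : MonoidalCategory) (Q : Coequalizers C).
Hypothesis flat : forall M : C, coflat M.
Variables (R S : Alg C) (i : AlgHom R S).

Local Notation SRR := (ext_RR i).
Local Notation SRS := (ext_RS i).
Local Notation D := (bim_monoidal Q flat R).
Local Notation A := (ext_alg Q flat i).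
Local Notation q U V := (tens_q Q (bim_r U) (bim_l V)).
Local Notation F := (restrr_functor i R).
Local Notation G := (tens_functor Q flat R SRS).

Section Action.
Variable X : Bim R S.

Lemma ext_act_bal :
  bim_ract X ∘ (bim_ract (restrr i X) ⊠ idm (S : C))
  = bim_ract X ∘ ((idm (X : C) ⊠ bim_lact SRR) ∘ assoc X R S).
Proof.
rewrite /= thomR thomL compA bim_ractA -!compA; congr (_ ∘ _).
by rewrite assocNM.
Qed.

Definition ext_act_map : Hom (tens_bim Q flat (restrr i X) SRR : C) (X : C) :=
  coeq_desc (tens_qP Q (bim_r (restrr i X)) (bim_l SRR)) ext_act_bal.

Lemma ext_actE : ext_act_map ∘ q (restrr i X) SRR = bim_ract X.
Proof. exact: coeq_descE. Qed.

Program Definition ext_act : BimHom (tens_bim Q flat (restrr i X) SRR) (restrr i X) :=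
  {| bim_map := ext_act_map |}.
Next Obligation.
apply: (coeq_epi (tens_qPl Q flat (restrr i X) SRR R)).
rewrite -!compA -thomL ext_actE (tens_lactE Q flat (restrr i X) SRR) !compA ext_actE /=.
by rewrite bim_lract -!compA assocVK compm1.
Qed.
Next Obligation.
apply: (coeq_epi (tens_qPr Q flat (restrr i X) SRR R)).
rewrite -!compA -thomR ext_actE (tens_ractE Q flat (restrr i X) SRR) !compA ext_actE /=.
rewrite -(compA _ _ (bim_ract X ⊠ _)) -thom_swap compA bim_ractA thomL -!compA.
by rewrite assocNR.
Qed.

End Action.

Lemma ext_actA (X : Bim R S) :
  ext_act_map X ∘ tens_map Q flat (ext_act X) (bimhom_id SRR)
  = ext_act_map X ∘ tens_map Q flat (bimhom_id (restrr i X)) (ext_mul Q flat i)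
    ∘ tens_assoc_map Q flat (restrr i X) SRR SRR.
Proof.
apply: tens3_epi.
have E := tens_assocE Q flat (restrr i X) SRR SRR; rewrite -!compA in E.
rewrite -!compA E !(comp_pre (tens_mapE Q flat _ _)) /= -!compA.
rewrite !(comp_pre (ext_actE _)) -thomR ext_actE.
by rewrite (comp_pre (eq_sym (thomL _ _ _))) ext_mulE bim_ractA -compA.
Qed.

Lemma ext_act1 (X : Bim R S) :
  ext_act_map X ∘ tens_map Q flat (bimhom_id (restrr i X)) (ext_one i)
  = tens_runit_map Q flat (restrr i X).
Proof.
apply: tens_epi.
rewrite -!compA (tens_mapE Q flat (bimhom_id (restrr i X)) (ext_one i)).
by rewrite (comp_pre (ext_actE _)) tens_runitE.
Qed.

Lemma ext_actN (X X' : Bim R S) (f : BimHom X X') :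
  f ∘ ext_act_map X
  = ext_act_map X' ∘ tens_map Q flat (restrr_hom i f) (bimhom_id SRR).
Proof.
apply: tens_epi.
rewrite -!compA (tens_mapE Q flat (restrr_hom i f) (bimhom_id SRR)).
by rewrite (comp_pre (ext_actE _)) ext_actE; exact: (bim_mapr f).
Qed.

Lemma restrr_hom_inj (X X' : Bim R S) (f g : BimHom X X') :
  restrr_hom i f = restrr_hom i g -> f = g.
Proof. by move/(f_equal (@bim_map _ _ _ _ _)) => E; apply: bimhom_ext. Qed.

(** Right [S]-linearity is [E] composed with the quotient map onto the tensor product over [R]. *)
Definition ext_lift (X X' : Bim R S) (h : BimHom (restrr i X) (restrr i X'))
    (E : h ∘ ext_act_map X = ext_act_map X' ∘ tens_map Q flat h (bimhom_id SRR)) :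
  BimHom X X'.
Proof.
refine (@Build_BimHom C R S X X' h (bim_mapl h) _).
by rewrite -(ext_actE X) compA E -compA (tens_mapE Q flat h (bimhom_id SRR)) compA ext_actE.
Defined.

(** Both objects are coequalizers of the same pair by conversion, so the underlying map is an
    identity and only the actions have to be compared. *)
Program Definition ext_free_iso (Y : Bim R R) :
    BimHom (restrr i (tens_bim Q flat Y SRS)) (tens_bim Q flat Y SRR) :=
  {| bim_map := idm _ |}.
Next Obligation.
rewrite comp1m thom1 compm1.
apply: (coeq_epi (tens_qPl Q flat Y SRS R)).
exact: (eq_trans (tens_lactE Q flat Y SRS) (eq_sym (tens_lactE Q flat Y SRR))).
Qed.
Next Obligation.
rewrite comp1m thom1 compm1.
apply: (coeq_epi (tens_qPr Q flat Y SRS R)).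
rewrite -compA -thom_swap compA (tens_ractE Q flat Y SRS).
rewrite [RHS](tens_ractE Q flat Y SRR) /=.
by rewrite thomL -!compA assocNR.
Qed.

Definition ext_free_iso_inv (Y : Bim R R) :
    BimHom (tens_bim Q flat Y SRR) (restrr i (tens_bim Q flat Y SRS)) :=
  bimhom_inv (f := ext_free_iso Y) (comp1m (idm _)) (comp1m (idm _)).

Lemma ext_free_isoN (Y Y' : Bim R R) (f : BimHom Y Y') :
  tens_map Q flat f (bimhom_id SRS) = tens_map Q flat f (bimhom_id SRR).
Proof.
apply: tens_epi; rewrite tens_mapE.
exact: (eq_sym (tens_mapE Q flat f (bimhom_id SRR))).
Qed.

Lemma ext_free_act (Y : Bim R R) :
  ext_act_map (tens_bim Q flat Y SRS)
  = tens_map Q flat (bimhom_id Y) (ext_mul Q flat i) ∘ tens_assoc_map Q flat Y SRR SRR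
    ∘ tens_map Q flat (ext_free_iso Y) (bimhom_id SRR).
Proof.
apply: tens_epi; rewrite ext_actE -!compA tens_mapE /=.
apply: (coeq_epi (tens_qPr Q flat Y SRS S)).
rewrite (tens_ractE Q flat Y SRS) thom1 compm1 -!compA.
have E := tens_assocE Q flat Y SRR SRR; rewrite -!compA in E; rewrite E.
rewrite (comp_pre (tens_mapE Q flat (bimhom_id Y) (ext_mul Q flat i))) /= -!compA.
by rewrite (comp_pre (eq_sym (thomL _ _ _))) ext_mulE.
Qed.

Program Definition ext_module_model : module_model A F G := {|
  act := fun X : Bim R S => ext_act X;
  fmap_inj := fun (X X' : Bim R S) f g => @restrr_hom_inj X X' f g;
  lift := fun (X X' : Bim R S) h E => ext_lift (f_equal (@bim_map _ _ _ _ _) E);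
  free_iso := fun Y : Bim R R => ext_free_iso Y;
  free_iso_inv := fun Y : Bim R R => ext_free_iso_inv Y
|}.
Next Obligation. by apply: bimhom_ext; apply: ext_actA. Qed.
Next Obligation. by apply: bimhom_ext; apply: ext_act1. Qed.
Next Obligation. by apply: bimhom_ext; apply: ext_actN. Qed.
Next Obligation. exact: bimhom_ext. Qed.
Next Obligation. by apply: bimhom_ext; apply: comp1m. Qed.
Next Obligation. by apply: bimhom_ext; apply: comp1m. Qed.
Next Obligation.
by apply: bimhom_ext; rewrite /= comp1m compm1; apply: ext_free_isoN.
Qed.
Next Obligation. by apply: bimhom_ext; rewrite /= comp1m; apply: ext_free_act. Qed.

End ExtensionModules.

(** * Uniqueness of left adjoints *)

Section LeftAdjoints.
Variables (C D : Category) (F : Functor C D).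

Section Comparison.
Variables (G G' : Functor D C).
Variables (eta : forall Y : D, Hom Y (F (G Y))) (eps : forall X : C, Hom (G (F X)) X).
Variables (eta' : forall Y : D, Hom Y (F (G' Y))) (eps' : forall X : C, Hom (G' (F X)) X).
Hypotheses
  (epsN : forall (X X' : C) (f : Hom X X'), f ∘ eps X = eps X' ∘ fmap G (fmap F f))
  (eta'N : forall (Y Y' : D) (f : Hom Y Y'),
    fmap F (fmap G' f) ∘ eta' Y = eta' Y' ∘ f)
  (eps_eta : forall Y : D, eps (G Y) ∘ fmap G (eta Y) = idm (G Y))
  (eps'_eta' : forall X : C, fmap F (eps' X) ∘ eta' (F X) = idm (F X)).

Lemma left_adjoint_compN (Y Y' : D) (f : Hom Y Y') :
  fmap G' f ∘ (eps (G' Y) ∘ fmap G (eta' Y))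
  = eps (G' Y') ∘ fmap G (eta' Y') ∘ fmap G f.
Proof. by rewrite compA epsN -!compA -!fmapM eta'N. Qed.

(** Naturality brings the two units and the two counits together, and the triangle identities cancel
    them. Used with both orders of the adjoints, it makes the comparison map invertible. *)
Lemma left_adjoint_compK (Y : D) :
  eps' (G Y) ∘ fmap G' (eta Y) ∘ (eps (G' Y) ∘ fmap G (eta' Y)) = idm (G Y).
Proof.
rewrite -compA left_adjoint_compN !compA epsN -(compA (eps _)) -fmapM.
by rewrite eps'_eta' fmap1 compm1.
Qed.

End Comparison.

(** Two left adjoints of [F] are isomorphic, and right adjointness to [F] is transported along the
    isomorphism. *)
Lemma left_adjoint_transfer (G G' : Functor D C) :
  adjoint_functors G F -> adjoint_functors G' F -> adjoint_functors F G' ->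
  adjoint_functors F G.
Proof.
move=> [eta [eps [etaN [epsN [t1 t2]]]]] [eta' [eps' [eta'N [eps'N [t1' t2']]]]].
move=> [u [c [uN [cN [s1 s2]]]]].
pose phi Y := eps (G' Y) ∘ fmap G (eta' Y).
pose psi Y := eps' (G Y) ∘ fmap G' (eta Y).
have phiK Y : psi Y ∘ phi Y = idm (G Y) by apply: left_adjoint_compK.
have psiK Y : phi Y ∘ psi Y = idm (G' Y) by apply: left_adjoint_compK.
have phiN Y Y' (f : Hom Y Y') : fmap G' f ∘ phi Y = phi Y' ∘ fmap G f.
  exact: left_adjoint_compN.
have psiN Y Y' (f : Hom Y Y') : fmap G f ∘ psi Y = psi Y' ∘ fmap G' f.
  exact: left_adjoint_compN.
move: phi psi phiK psiK phiN psiN => phi psi phiK psiK phiN psiN.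
exists (fun X => psi (F X) ∘ u X), (fun Y => c Y ∘ fmap F (phi Y)).
split; [|split; [|split]].
- by move=> X X' f; rewrite compA psiN -!compA uN.
- by move=> Y Y' f; rewrite compA cN -!compA -!fmapM phiN.
- by move=> X; rewrite fmapM -!compA (comp_pre (eq_sym (fmapM F _ _))) psiK fmap1 comp1m s1.
- by move=> Y; rewrite compA psiN fmapM -!compA uN (comp_pre (s2 _)) comp1m phiK.
Qed.

End LeftAdjoints.

(** * Equivalence of the characterizations of Frobenius extensions *)

Theorem corollary5p2
    (C : MonoidalCategory) (Q : Coequalizers C)
    (flat : forall M : C, coflat M)
    (robust : forall (T : Alg C) (Y : LMod T), left_robust Q Y)
    (R S : Alg C) (i : AlgHom R S) :
  let D : MonoidalCategory := bim_monoidal Q flat R in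
  let A : Alg D := ext_alg Q flat i in
  let F : Functor (bim_cat R S) (bim_cat R R) := restrr_functor i R in
  let G : Functor (bim_cat R R) (bim_cat R S) := tens_functor Q flat R (ext_RS i) in
  let P1 := frobenius_extension Q flat i in
  let P2 := exists d : LeftDual (A : D),
    right_modules_isomorphic (mul A) (ldual_ract d) in
  let P3 := exists d : RightDual (A : D),
    left_modules_isomorphic (mul A) (rdual_lact d) in
  let P4 := exists (delta : Hom (A : D) (A ⊗ A)) (eps : Hom (A : D) unit),
    is_coalgebra delta eps /\ bilinear_comul delta in
  let P5 := exists (d : RightDual (A : D)) (B : Hom (A ⊗ A) (unit : D)),
    associative B /\ is_iso (Phi_r d B) in
  let P6 := exists (d : LeftDual (A : D)) (B : Hom (A ⊗ A) (unit : D)),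
    associative B /\ is_iso (Phi_l d B) in
  let P7 := exists (rho : Hom (unit : D) (A ⊗ A)) (lam : Hom (A ⊗ A) (unit : D)),
    is_adjunction rho lam /\ associative lam in
  let P8 := exists (rho : Hom (unit : D) (A ⊗ A)) (lam : Hom (A ⊗ A) (unit : D)),
    is_adjunction rho lam /\
    exists theta : Hom (A : D) unit, lam = theta ∘ mul A in
  let P9 := adjoint_functors F G in
  ((P1 <-> P2) /\ (P1 <-> P3) /\ (P1 <-> P4) /\ (P1 <-> P5) /\ (P1 <-> P6) /\
   (P1 <-> P7) /\ (P1 <-> P8)) /\
  (left_tensor_generator (unit : D) -> (P1 <-> P9)) /\
  (P9 <-> frobenius_functor F).
Proof.
move=> D A F G P1 P2 P3 P4 P5 P6 P7 P8 P9.
have P7_P1 : P7 -> P1.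
  move=> /frobenius_form_coalgebra [delta [eps [co bi]]].
  exact: coalgebra_frobenius_extension co bi.
have P1_P7 : P1 -> P7 by apply: frobenius_extension_form.
have P4_P1 : P4 -> P1.
  by move=> [delta [eps [co bi]]]; apply: coalgebra_frobenius_extension co bi.
have P2_P7 : P2 -> P7 by move=> [d]; apply: iso_modules_frobenius_form.
have P3_P7 : P3 -> P7 by move=> [d]; apply: iso_modules_frobenius_form_r.
have P5_P3 : P5 -> P3.
  by move=> [d [B [BA iso]]]; exists d; apply: Phi_r_iso_modules BA iso.
have P6_P2 : P6 -> P2.
  by move=> [d [B [BA iso]]]; exists d; apply: Phi_l_iso_modules BA iso.
have P7_P5 : P7 -> P5 by apply: frobenius_form_Phi_r.
have P7_P6 : P7 -> P6 by apply: frobenius_form_Phi_l.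
have P7_P8 : P7 -> P8.
  move=> [rho [lam [adj lamA]]]; exists rho, lam; split=> //.
  by exists (form_counit lam); rewrite form_counit_mul.
have P8_P7 : P8 -> P7.
  move=> [rho [lam [adj [theta E]]]]; exists rho, lam; split=> //.
  by rewrite E; apply: associative_comp_mul.
have P7_P4 : P7 -> P4 by apply: frobenius_form_coalgebra.
have model : module_model A F G := ext_module_model Q flat i.
(* [G] is always left adjoint to [F]; it therefore witnesses that [F] is Frobenius once it is also a
   right adjoint, and it is isomorphic to any other witness. *)
have GF : adjoint_functors G F := free_adjoint model.
split; [|split].
(* Besides [P1 <-> P7] and [P7 <-> P8], the cycles are [P7 -> P4 -> P1], [P7 -> P5 -> P3 -> P7] and
   [P7 -> P6 -> P2 -> P7]. *)
- by tauto.
- move=> gen; split=> [/P1_P7 [rho [lam [adj lamA]]] | FG].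
    exact: (form_adjoint model adj lamA).
  exact: P7_P1 (adjoint_frobenius_form model gen FG).
- split=> [FG | [G' [FG' G'F]]]; first by exists G.
  exact: left_adjoint_transfer GF G'F FG'.
Qed.
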